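(* Let $\mathcal X\subset\mathbb R^d$ be bounded and satisfy an interior cone condition, and let $A:\mathcal H_1\to\mathcal H_2$ be a compact linear operator of the form $(Aw)(x)=\langle w,\phi_x\rangle_{\mathcal H_1}$ with $\|\phi_x\|_{\mathcal H_1}\le c$ for all $x\in\mathcal X$. Assume that $R(A)=\mathcal H_K(\mathcal X)\hookrightarrow W_2^\tau(\mathcal X)$ continuously, with embedding constant $C_e$, for some $\tau>d/2$. Let $g\in R(A)$, $f=A^\dagger g$, $\mathcal X_n=\{x_1,\dots,x_n\}\subset\mathcal X$ with $h_{\mathcal X_n,\mathcal X}\le h_0$, $\lambda>0$, let $y^\delta=y+\delta$ with $y_i=g(x_i)$ and $\delta_1,\dots,\delta_n$ i.i.d. Gaussian with mean $0$ and variance $\nu^2$, and let $\hat f^{(\delta,n)}_{s_\lambda}=s_\lambda(A_n^*A_n)A_n^*y^\delta$. Then for each $\psi\in\mathcal A_1(\mathcal F)$ with coefficient sequence $\alpha$, $$\mathbb E\left|\langle\psi,\hat f^{(\delta,n)}_{s_\lambda}-f\rangle_{\mathcal H_1}\right|\le\|\alpha\|_{\ell_1}\left(C_f\left(h_{\mathcal X_n,\mathcal X}^{\tau-\frac d2}+\lambda^{\frac12}\right)+c^2\frac{\nu}{\sqrt n}\frac E\lambda\right),$$ where $C_f=C'\|g\|_{\mathcal H_K}$. Hence this error bound becomes minimal (as a function of $\lambda$) for $$\lambda\simeq\left(\frac{\nu^2}{n}\right)^{\frac13}.$$ If $A^*A$ is of trace class, then $$\mathbb E\left|\langle\psi,\hat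 f^{(\delta,n)}_{s_\lambda}-f\rangle_{\mathcal H_1}\right|\le\|\alpha\|_{\ell_1}\left(C_f\left(h_{\mathcal X_n,\mathcal X}^{\tau-\frac d2}+\lambda^{\frac12}\right)+c\,\frac{\nu}{n}\frac E\lambda C''\right),$$ where $C''>0$ is the constant bounding the trace norm of $A_n^*A_n$. Hence this error bound becomes minimal for $$\lambda\simeq\left(\frac{\nu}{n}\right)^{\frac23}.$$
   Context: $\mathcal H_1$ is a Hilbert space and $\mathcal H_2$ a Hilbert space of real functions on $\mathcal X$. $A$ has a singular system $\{(\sigma_j,u_j,v_j)\}_j$ with $\sigma_j>0$ non-increasing, and $\phi_x:=\sum_j\sigma_ju_j(x)v_j$ is assumed to converge in $\mathcal H_1$ for every $x\in\mathcal X$, so that $(Aw)(x)=\langle w,\phi_x\rangle_{\mathcal H_1}$. $R(A)$ is the range; $A^\dagger$ is the Moore–Penrose pseudoinverse. The range $R(A)=\mathcal H_K$ is a reproducing kernel Hilbert space with kernel $K(x,x')=\langle\phi_x,\phi_{x'}\rangle_{\mathcal H_1}$ and inner product $\langle g,h\rangle_{\mathcal H_K}=\langle A^\dagger g,A^\dagger h\rangle_{\mathcal H_1}$. The fill distance is $h_{\mathcal X_n,\mathcal X}:=\sup_{x\in\mathcal X}\min_{x_i\in\mathcal X_n}\|x-x_i\|_2$. The symbol $\simeq$ means equality up to positive multiplicative factors not depending on $n$, $\nu$, $h_{\mathcal X_n,\mathcal X}$. $W_2^\tau(\mathcal X)$ is the (possibly fractional, Sobolev–Slobodeckij) Sobolev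 space; the embedding constant satisfies $|g|_{W_2^\tau(\mathcal X)}\le\|g\|_{W_2^\tau(\mathcal X)}\le C_e\|g\|_{\mathcal H_K(\mathcal X)}$. Test functions: $\mathcal F:=\overline{\mathrm{span}\{\phi_x:x\in\mathcal X\}}=N(A)^\perp$ and $\mathcal A_1(\mathcal F):=\{\psi=\sum_{i\in\mathbb N}\alpha_i\phi_{\xi_i}:\ \xi_i\in\mathcal X,\ \sum_{i\in\mathbb N}|\alpha_i|<\infty\}\subseteq\mathcal F$; $\alpha=(\alpha_i)_i$ is the coefficient sequence of such a representation of $\psi$. Semi-discrete operator: $A_n:\mathcal H_1\to\mathbb R^n$, $(A_nf)_i=\langle f,\phi_{x_i}\rangle_{\mathcal H_1}=(Af)(x_i)$; with the normalized inner product on $\mathbb R^n$ its adjoint is $A_n^*w=\frac1n\sum_{i=1}^nw_i\phi_{x_i}$. Expectation is over the noise $\delta$. Regularization function: $s_\lambda:[0,\infty)\to\mathbb R$, $\lambda>0$, is a family such that, with $I=[0,\|A_n\|^2]$: (1) $\sup_{t\in I}|t\,s_\lambda(t)|\le D$ uniformly in $\lambda>0$; (2) $\sup_{\lambda>0}\sup_{t\in I}|\lambda s_\lambda(t)|\le E$; (3) there is a qualification $q\ge1/2$ and constants $C_a>0$ with $\sup_{t\in I}|t^a(1-ts_\lambda(t))|\le C_a\lambda^a$ for all $\lambda>0$, $0\le a\le q$. $s_\lambda(A_n^*A_n)$ is defined by spectral calculus. Constants: $C,h_0>0$ are constants for which the sampling inequality $\|z\|_{L_\infty(\mathcal X)}\le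 C\big(h_{\mathcal X_n,\mathcal X}^{\tau-d/2}|z|_{W_2^\tau(\mathcal X)}+\|z_{|\mathcal X_n}\|_2\big)$ holds for all $z\in W_2^\tau(\mathcal X)$ and all finite $\mathcal X_n\subset\mathcal X$ with $h_{\mathcal X_n,\mathcal X}\le h_0$ (such constants exist by a known theorem), and $C':=C\max\{C_e(D+1),C_{1/2}\}$.
   Formalization: The sampling inequality is assumed with the 1/n-normalized norm of z on X_n, for a class of point sets containing X_n; in the trace part C''^2 must also bound n times the trace norm of A_n^*A_n; the minimality claims assume g≠0, ‖α‖_1>0, c>0, E>0. As stated the bounds fail. *)

(* Defs.v *)
From HB Require Import structures.
From mathcomp Require Import all_boot all_order all_algebra.
From mathcomp Require Import all_classical all_reals all_analysis.

Set Implicit Arguments.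
Unset Strict Implicit.
Unset Printing Implicit Defensive.

Import Order.TTheory GRing.Theory Num.Theory numFieldNormedType.Exports.

Local Open Scope classical_set_scope.
Local Open Scope ring_scope.

(* Points of R^d are row vectors 'rV[R]_d.  The library norm on 'rV[R]_d is   *)
(* the sup norm, hence the separate Euclidean norm enorm; the topology is the *)
(* same.                                                                      *)

Section lebesgue_measure_Rd.
Context (R : realType).

Definition coordinate_sets (d : nat) : set (set 'rV[R]_d) :=
  [set A | exists (i : 'I_d) (B : set R), measurable B /\ A = [set v : 'rV[R]_d | B (v 0 i)]].

(* 'rV[R]_d with its Borel sigma-algebra, generated by the coordinate slabs. *)
Definition Rd (d : nat) := g_sigma_algebraType (@coordinate_sets d).

Lemma measurable_coord d (i : 'I_d) :
  measurable_fun [set: Rd d] (fun v : Rd d => (v : 'rV[R]_d) 0 i).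
Proof.
move=> _ B mB; rewrite setTI; apply: sub_sigma_algebra.
by exists i, B.
Qed.

Lemma measurable_fun_Rd d e (T : measurableType e) (f : T -> Rd d) :
  (forall i, measurable_fun [set: T] (fun t => (f t : 'rV[R]_d) 0 i)) ->
  measurable_fun [set: T] f.
Proof.
move=> mf; apply: (@measurability _ _ T (Rd d) setT f (@coordinate_sets d)) => //.
by move=> _ [_ [i [B [mB ->]]] <-]; exact: mf.
Qed.

Definition cons_Rd d (p : measurableTypeR R * Rd d) : Rd d.+1 :=
  row_mx (const_mx p.1 : 'rV_1) (p.2 : 'rV_d).

Lemma cons_Rd_head d (p : measurableTypeR R * Rd d) (j : 'I_1) :
  (cons_Rd p : 'rV_(1 + d)) 0 (lshift d j) = p.1.
Proof.
exact: etrans (row_mxEl (const_mx p.1) (p.2 : 'rV_d) 0 j) (mxE _ _ _ _).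
Qed.

Lemma cons_Rd_tail d (p : measurableTypeR R * Rd d) (j : 'I_d) :
  (cons_Rd p : 'rV_(1 + d)) 0 (rshift 1 j) = (p.2 : 'rV_d) 0 j.
Proof. exact: (row_mxEr (const_mx p.1 : 'rV_1) (p.2 : 'rV_d) 0 j). Qed.

Lemma measurable_cons_Rd d : measurable_fun [set: _] (@cons_Rd d).
Proof.
apply: measurable_fun_Rd => i; case: (@split_ordP 1 d i) => [j|j] -> /=.
  apply: (eq_measurable_fun fst) => // p _.
  exact/esym/cons_Rd_head.
apply: (eq_measurable_fun (fun p : measurableTypeR R * Rd d => (p.2 : 'rV_d) 0 j)).
  by move=> p _; exact/esym/cons_Rd_tail.
exact: measurableT_comp (@measurable_coord d j) measurable_snd.
Qed.

Section step.
Context (d : nat) (m : {sigma_finite_measure set (Rd d) -> \bar R}).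

Definition lebesgue_step : set (Rd d.+1) -> \bar R :=
  pushforward (lebesgue_measure \x m)%E (@cons_Rd d).

Let step0 : lebesgue_step set0 = 0%E.
Proof. by rewrite /lebesgue_step /pushforward preimage_set0 measure0. Qed.

Let step_ge0 A : (0 <= lebesgue_step A)%E.
Proof. by rewrite /lebesgue_step /pushforward measure_ge0. Qed.

Let step_additive : semi_sigma_additive lebesgue_step.
Proof.
move=> F mF tF mUF; rewrite /lebesgue_step /pushforward preimage_bigcup.
have mc A : measurable A -> measurable (@cons_Rd d @^-1` A).
  by move=> mA; rewrite -[X in measurable X]setTI; exact: measurable_cons_Rd.
apply: measure_semi_sigma_additive.
- by move=> n; exact: mc.
- apply/trivIsetP => /= i j _ _ ij; rewrite -preimage_setI.
  by move/trivIsetP : tF => /(_ _ _ _ _ ij) ->//; rewrite preimage_set0.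
- by rewrite -preimage_bigcup; exact: mc.
Qed.

HB.instance Definition _ := isMeasure.Build _ _ _
  lebesgue_step step0 step_ge0 step_additive.

Let uncons (v : Rd d.+1) : measurableTypeR R * Rd d :=
  ((v : 'rV_(1 + d)) 0 (lshift d 0), \row_j (v : 'rV_(1 + d)) 0 (rshift 1 j)).

Let measurable_uncons : measurable_fun [set: _] uncons.
Proof.
apply/measurable_fun_pairP; split => /=; first exact: measurable_coord.
apply: measurable_fun_Rd => j /=.
apply: (eq_measurable_fun (fun v : Rd d.+1 => (v : 'rV_(1 + d)) 0 (rshift 1 j))).
  by move=> v _ /=; rewrite mxE.
exact: measurable_coord.
Qed.

Let consK p : uncons (cons_Rd p) = p.
Proof.
case: p => t v; congr (_, _); first exact: cons_Rd_head.
by apply/rowP => j; rewrite mxE cons_Rd_tail.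
Qed.

Let step_sigma_finite : sigma_finite setT lebesgue_step.
Proof.
have /sigma_finiteP[F [TF ndF Foo]] :=
  sigma_finiteT (@lebesgue_measure R : {sigma_finite_measure set _ -> \bar R}).
have /sigma_finiteP[G [TG ndG Goo]] := sigma_finiteT m.
exists (fun n => uncons @^-1` (F n `*` G n)).
  rewrite -preimage_bigcup (_ : \bigcup_n _ = setT) ?preimage_setT//.
  rewrite -subTset => -[x y] _.
  have [i _ Fx] : (\bigcup_i F i) x by rewrite -TF.
  have [j _ Gy] : (\bigcup_i G i) y by rewrite -TG.
  exists (maxn i j) => //; split.
  - by move: x Fx; exact/subsetPset/ndF/leq_maxl.
  - by move: y Gy; exact/subsetPset/ndG/leq_maxr.
move=> n; have [mF Fn] := Foo n; have [mG Gn] := Goo n; split.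
  rewrite -[X in measurable X]setTI; apply: measurable_uncons => //.
  exact: measurableX.
rewrite /lebesgue_step /pushforward (_ : _ @^-1` _ = F n `*` G n); last first.
  by rewrite -comp_preimage (_ : _ \o _ = id)//; apply/funext => p; exact: consK.
by rewrite product_measure1E// lte_mul_pinfty// ge0_fin_numE.
Qed.

HB.instance Definition _ := Measure_isSigmaFinite.Build _ _ _
  lebesgue_step step_sigma_finite.
End step.

(* d-dimensional Lebesgue measure, as an iterated product measure. *)
Fixpoint lebesgue_Rd (d : nat) : {sigma_finite_measure set (Rd d) -> \bar R} :=
  match d with
  | 0 => \d_(0 : Rd 0)
  | k.+1 => lebesgue_step (lebesgue_Rd k)
  end.
End lebesgue_measure_Rd.

Section euclidean_geometry.
Context (R : realType) (d : nat).
Implicit Types (X : set 'rV[R]_d) (v w : 'rV[R]_d).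

Definition edot v w : R := \sum_(i < d) v 0 i * w 0 i.

Definition enorm v : R := Num.sqrt (edot v v).

Definition interior_cone_condition X : Prop :=
  exists theta r : R,
    [/\ 0 < theta < pi / 2, 0 < r &
      forall x, X x -> exists2 xi, enorm xi = 1 &
        forall y l, enorm y = 1 -> cos theta <= edot y xi -> 0 <= l <= r ->
          X (x + l *: y)].

(* The inf is a min, since x has finitely many entries; it is meaningful for  *)
(* n > 0 only.                                                                *)
Definition fill_distance X n (x : 'I_n -> 'rV[R]_d) : R :=
  sup [set inf (range (fun i => enorm (p - x i))) | p in X].

End euclidean_geometry.

Section sobolev_slobodeckij.
Context (R : realType) (d : nat).
Implicit Types (O X : set 'rV[R]_d) (f z w : 'rV[R]_d -> R).
Local Notation mu := (@lebesgue_Rd R d).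

Definition partial (i : 'I_d) f : 'rV[R]_d -> R := fun x => 'D_('e_i) f x.

Definition smooth f : Prop :=
  forall s : seq 'I_d,
    continuous (foldr partial f s) /\
    forall i x, derivable (foldr partial f s) x 'e_i.

Definition test_function O f : Prop :=
  [/\ smooth f, compact (closure [set x | f x != 0]) &
      closure [set x | f x != 0] `<=` O].

Definition mderiv (a : 'I_d -> nat) f : 'rV[R]_d -> R :=
  foldr (fun i => iter (a i) (partial i)) f (enum 'I_d).

Definition morder (a : 'I_d -> nat) : nat := (\sum_(i < d) a i)%N.

Definition sqr_L2 O w : \bar R := (\int[mu]_(x in O) (w x ^+ 2)%:E)%E.

Definition weak_derivative O z (a : 'I_d -> nat) w : Prop :=
  [/\ measurable_fun (O : set (Rd R d)) (w : Rd R d -> R), (sqr_L2 O w < +oo)%E &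
    forall f, test_function O f ->
      (\int[mu]_(x in O) (z x * mderiv a f x)%:E =
       ((-1) ^+ morder a)%:E * \int[mu]_(x in O) (w x * f x)%:E)%E].

(* Some square integrable weak derivative if there is one; it is then unique  *)
(* up to a null set, so that the norms below do not depend on the choice.     *)
Definition weak_deriv O z (a : 'I_d -> nat) : 'rV[R]_d -> R :=
  xget (fun=> 0) [set w | weak_derivative O z a w].

Definition sqr_slobodeckij O (s : R) w : \bar R :=
  (\int[mu]_(x in O) \int[mu]_(y in O)
     ((w x - w y) ^+ 2 / enorm (x - y) `^ (d%:R + 2 * s))%:E)%E.

(* tau = k + s with k = Num.truncn tau and 0 <= s < 1.                        *)
Definition frac_part (tau : R) : R := tau - (Num.truncn tau)%:R.

(* Multi-indices of order at most k are the functions 'I_d -> 'I_k.+1 of      *)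
(* order at most k.                                                           *)
Definition mindex (k : nat) := {ffun 'I_d -> 'I_k.+1}.

Definition nat_mindex k (a : mindex k) : 'I_d -> nat := fun i => a i.
Coercion nat_mindex : mindex >-> Funclass.

Definition sqr_sobolev_seminorm O (tau : R) z : \bar R :=
  (\sum_(a : mindex (Num.truncn tau) | morder a == Num.truncn tau)
     if frac_part tau == 0%R then sqr_L2 O (weak_deriv O z a)
     else sqr_slobodeckij O (frac_part tau) (weak_deriv O z a))%E.

Definition sqr_sobolev_norm O (tau : R) z : \bar R :=
  (\sum_(a : mindex (Num.truncn tau) | (morder a <= Num.truncn tau)%N)
     sqr_L2 O (weak_deriv O z a)
   + if frac_part tau == 0%R then 0 else sqr_sobolev_seminorm O tau z)%E.

(* W_2^tau(X) for tau > d/2, whose elements are identified with their         *)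
(* continuous representatives, so that point values make sense.  X need not   *)
(* be open: weak derivatives and integrals are taken on its interior.         *)
Definition sobolev X (tau : R) z : Prop :=
  [/\ {within X, continuous z},
      forall a : mindex (Num.truncn tau), (morder a <= Num.truncn tau)%N ->
        exists w, weak_derivative X° z a w &
      (sqr_sobolev_norm X° tau z < +oo)%E].

Definition sobolev_seminorm X tau z : R :=
  Num.sqrt (fine (sqr_sobolev_seminorm X° tau z)).

Definition sobolev_norm X tau z : R :=
  Num.sqrt (fine (sqr_sobolev_norm X° tau z)).

(* Applied to functions continuous on X only, for which it is the             *)
(* L_oo-norm.                                                                 *)
Definition Linfty_norm X z : \bar R := ereal_sup [set `|z x|%:E | x in X].

(* The Euclidean norm on R^n for the inner product normalized by 1/n.         *)
Definition nnorm n (w : 'rV[R]_n) : R :=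
  Num.sqrt (n%:R^-1 * \sum_(i < n) w 0 i ^+ 2).

(* The sampling inequality with constants C, h0 for the point sets belonging  *)
(* to a class of designs; [designs] can be the class of all finite families.  *)
Definition sampling_inequality X (tau C h0 : R)
    (designs : forall n, set ('I_n -> 'rV[R]_d)) : Prop :=
  forall n (x : 'I_n -> 'rV[R]_d), (0 < n)%N -> designs n x ->
    (forall i, X (x i)) -> fill_distance X x <= h0 ->
    forall z, sobolev X tau z ->
      (Linfty_norm X z <=
       (C * (fill_distance X x `^ (tau - d%:R / 2) * sobolev_seminorm X tau z
             + nnorm (\row_(i < n) z (x i))))%:E)%E.

End sobolev_slobodeckij.

(* A real Hilbert space is a completeNormedModType R with a positive definite *)
(* symmetric bilinear form ip inducing its norm.                              *)
Definition inner_product (R : realType) (H : completeNormedModType R)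
    (ip : {dot H for idfun}) : Prop :=
  forall w, ip w w = `|w| ^+ 2.

Definition orthonormal_on (R : realType) (H : completeNormedModType R)
    (ip : {dot H for idfun}) (I : eqType) (J : set I) (e : I -> H) : Prop :=
  forall i j, J i -> J j -> ip (e i) (e j) = (i == j)%:R.

Definition orthogonal_complement (R : realType) (H : completeNormedModType R)
    (ip : {dot H for idfun}) (V : set H) : set H :=
  [set w | forall v, V v -> ip w v = 0].

(* The trace norm (sum of the singular values) of T, as the supremum of       *)
(* sum_i |<T e_i, f_i>| over finite orthonormal systems.                      *)
Definition trace_norm (R : realType) (H : completeNormedModType R)
    (ip : {dot H for idfun}) (T : H -> H) : \bar R :=
  ereal_sup [set t | exists m (e f : 'I_m -> H),
    [/\ orthonormal_on ip setT e, orthonormal_on ip setT f &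
        t = (\sum_(i < m) `|ip (T (e i)) (f i)|)%:E]].

Definition trace_class (R : realType) (H : completeNormedModType R)
    (ip : {dot H for idfun}) (T : H -> H) : Prop :=
  (trace_norm ip T < +oo)%E.

(* S = s(T) for a self-adjoint T of finite rank, through a spectral           *)
(* decomposition T = sum_i t_i <., e_i> e_i; s(0) acts on the orthogonal of   *)
(* the e_i.  S does not depend on the decomposition.                          *)
Definition spectral_calculus (R : realType) (H : completeNormedModType R)
    (ip : {dot H for idfun}) (s : R -> R) (T S : H -> H) : Prop :=
  exists m (e : 'I_m -> H) (t : 'I_m -> R),
    [/\ orthonormal_on ip setT e,
        forall w, T w = \sum_(i < m) (t i * ip w (e i)) *: e i &
        forall w, S w = \sum_(i < m) (s (t i) * ip w (e i)) *: e i
                        + s 0 *: (w - \sum_(i < m) ip w (e i) *: e i)].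

Section operators.
Context (R : realType) (H1 H2 : completeNormedModType R).
Context (ip1 : {dot H1 for idfun}) (ip2 : {dot H2 for idfun}).
Context (A : {linear H1 -> H2}).

Definition compact_operator : Prop :=
  compact (closure (A @` [set w | `|w| <= 1])).

Definition is_adjoint (B : H2 -> H1) : Prop :=
  forall w z, ip2 (A w) z = ip1 w (B z).

(* The index set J is nat or an initial segment of it.                        *)
Definition singular_system (J : set nat) (sigma : nat -> R)
    (u : nat -> H2) (v : nat -> H1) : Prop :=
  [/\ forall i j, (i <= j)%N -> J j -> J i,
      forall j, J j -> 0 < sigma j,
      forall i j, (i <= j)%N -> J j -> sigma j <= sigma i,
      orthonormal_on ip2 J u /\ orthonormal_on ip1 J v &
      forall w, series (fun j => if j \in J then (sigma j * ip1 w (v j)) *: u j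
                                 else 0) @ \oo --> A w].

(* f = A^dagger g: f lies in N(A)^perp and g - A f in R(A)^perp.              *)
Definition is_moore_penrose (g : H2) (f : H1) : Prop :=
  orthogonal_complement ip1 [set w | A w = 0] f /\
  orthogonal_complement ip2 (range A) (g - A f).

(* The value 0 outside of the domain R(A) + R(A)^perp is irrelevant.          *)
Definition moore_penrose (g : H2) : H1 := xget 0 [set f | is_moore_penrose g f].

Definition HK_inner (g h : H2) : R := ip1 (moore_penrose g) (moore_penrose h).

Definition HK_norm (g : H2) : R := Num.sqrt (HK_inner g g).

End operators.

Section semi_discrete.
Context (R : realType) (d : nat) (H : completeNormedModType R).
Context (ip : {dot H for idfun}) (phi : 'rV[R]_d -> H).
Context (n : nat) (x : 'I_n -> 'rV[R]_d).

Definition sampling_op (w : H) : 'rV[R]_n := \row_(i < n) ip w (phi (x i)).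

Definition sampling_adj (w : 'rV[R]_n) : H :=
  n%:R^-1 *: \sum_(i < n) w 0 i *: phi (x i).

Definition sampling_normal_op (w : H) : H := sampling_adj (sampling_op w).

Definition sampling_opnorm : R :=
  sup [set nnorm (sampling_op w) | w in [set w | `|w| <= 1]].

End semi_discrete.

(* H2 consists of real functions on X: ev z is the function z.                *)
Definition function_space (R : realType) (d : nat) (X : set 'rV[R]_d)
    (H2 : completeNormedModType R) (ev : H2 -> 'rV[R]_d -> R) : Prop :=
  (forall a z w x, X x -> ev (a *: z + w) x = a * ev z x + ev w x) /\
  (forall z w, (forall x, X x -> ev z x = ev w x) -> z = w).

(* psi = sum_i alpha_i phi_(xi_i) in A_1(F).                                  *)
Definition in_A1 (R : realType) (d : nat) (X : set 'rV[R]_d)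
    (H : completeNormedModType R) (phi : 'rV[R]_d -> H)
    (alpha : nat -> R) (psi : H) : Prop :=
  exists xi : nat -> 'rV[R]_d,
    [/\ forall i, X (xi i),
        cvgn (series (fun i => `|alpha i|)) &
        series (fun i => alpha i *: phi (xi i)) @ \oo --> psi].

Definition l1_norm (R : realType) (alpha : nat -> R) : R :=
  limn (series (fun i => `|alpha i|)).

(* b is the squared norm of A_n and I = [0, b].                               *)
Definition regularization_family (R : realType) (b : R) (s : R -> R -> R)
    (D E q : R) (Ca : R -> R) : Prop :=
  [/\ forall l t, 0 < l -> 0 <= t <= b -> `|t * s l t| <= D,
      forall l t, 0 < l -> 0 <= t <= b -> `|l * s l t| <= E,
      2^-1 <= q,
      forall a, 0 <= a <= q -> 0 < Ca a &
      forall a l t, 0 <= a <= q -> 0 < l -> 0 <= t <= b ->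
        `|t `^ a * (1 - t * s l t)| <= Ca a * l `^ a].

Definition iid_gaussian (R : realType) (dO : measure_display)
    (Omega : measurableType dO) (P : probability Omega R) (nu : R)
    (n : nat) (delta : 'I_n -> {RV P >-> R}) : Prop :=
  (forall i (B : set (measurableTypeR R)), measurable B ->
     distribution P (delta i) B = normal_prob 0 nu B) /\
  (forall B : 'I_n -> set (measurableTypeR R), (forall i, measurable (B i)) ->
     P (\bigcap_(i in [set: 'I_n]) (delta i @^-1` B i)) =
     (\prod_(i < n) P (delta i @^-1` B i))%E).

Definition error_bound (R : realType) (a1 Cf c E g : R)
    (n : nat) (nu h l : R) : R :=
  a1 * (Cf * (h `^ g + l `^ 2^-1) + c ^+ 2 * (nu / Num.sqrt n%:R) * (E / l)).

Definition trace_error_bound (R : realType) (a1 Cf c E C2 g : R)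
    (n : nat) (nu h l : R) : R :=
  a1 * (Cf * (h `^ g + l `^ 2^-1) + c * (nu / n%:R) * (E / l) * C2).

Definition minimizer (R : realType) (B : R -> R) (l : R) : Prop :=
  0 < l /\ forall l', 0 < l' -> B l <= B l'.

(* B n nu h becomes minimal for l ~ rate n nu, with factors independent of    *)
(* n, nu and h.                                                               *)
Definition minimal_for (R : realType) (B : nat -> R -> R -> R -> R)
    (rate : nat -> R -> R) : Prop :=
  exists k1 k2 : R, [/\ 0 < k1, 0 < k2 &
    forall n nu h, (0 < n)%N -> 0 < nu -> 0 <= h ->
      (exists l, minimizer (B n nu h) l) /\
      (forall l, minimizer (B n nu h) l ->
         k1 * rate n nu <= l <= k2 * rate n nu)].

(* Main.v *)
Require Import Defs.
From HB Require Import structures.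
From mathcomp Require Import all_boot all_order all_algebra.
From mathcomp Require Import all_classical all_reals all_analysis.
From mathcomp Require Import measurable_realfun.
From mathcomp Require Import ring lra.

Set Implicit Arguments.
Unset Strict Implicit.
Unset Printing Implicit Defensive.

Import Order.TTheory GRing.Theory Num.Theory numFieldNormedType.Exports.

Local Open Scope classical_set_scope.
Local Open Scope ring_scope.

(** Write [T] for [A_n^* A_n], [r l = 1 - l * s lam l], and let [S = s_lam(T)].
    As [S] is symmetric, the error splits into a deterministic and a random
    part ([error_decomposition]):
      [<psi, fhat - f> = - <psi, r(T) f>
          + n^-1 * sum_i delta_i <S psi, phi_(x_i)>].

    The bias is small at every feature: [<phi_y, z> = (A z)(y)] with
    [z = r(T) f], and the sampling inequality bounds the function [A z] by
    [h ^ (tau - d/2)] times its Sobolev seminorm plus the norm of its samples.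
    The seminorm is at most [Ce * |z| <= Ce * (D + 1) * |f|], because the
    pseudoinverse of [A z] is the projection of [z] and so not longer than [z];
    the norm of the samples is [sqrt <T z, z>], which the qualification at
    exponent 1/2 bounds by [C_(1/2) * sqrt lam * |f|].  A test function is an
    absolutely summable combination of features, so [bias_le] follows by
    linearity and continuity.

    The noise term is a linear combination of independent centred Gaussians.
    Its first absolute moment is at most its standard deviation
    ([expectation_affine_noise_le]), and that equals [nu / sqrt n] times the
    norm of the samples of [S psi].  If sampling has operator norm at most
    [kappa], this is at most [nu / sqrt n * kappa * E / lam * |psi|], with
    [|psi| <= c * |alpha|_1].  The two bounds of the theorem are the two choices
    [kappa = c], from [|phi_x| <= c], and [kappa = C'' / sqrt n], from
    [|A_n w|^2 = <T w, w> <= tr T * |w|^2].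

    Both bounds have, in [l], the form [b + A * sqrt l + K / l], whose unique
    minimizer is [(2 K / A) ^ (2/3)] ([tradeoff_minimizer]).

    The spectral calculus is only ever applied to an operator with a finite
    spectral decomposition; [spectral_fun] is that calculus, and its
    multiplicativity, symmetry and norm bound do all the work.  The Gaussian
    moments are obtained without integration by parts, by comparing the normal
    densities of different means and variances, all of integral one. *)

(** * Real Hilbert spaces *)

Section real_hilbert_space.
Context (R : realType) (H : completeNormedModType R).
Context (ip : {dot H for idfun}) (hip : inner_product ip).
Implicit Types (w z : H).

Lemma ipC w z : ip w z = ip z w.
Proof. by rewrite (hermC (theta := idfun) ip) /= expr0 mul1r. Qed.

Lemma ipZl a w z : ip (a *: w) z = a * ip w z.
Proof. by rewrite linearZl_LR. Qed.

Lemma ipZr a w z : ip w (a *: z) = a * ip w z.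
Proof. by rewrite ipC ipZl ipC. Qed.

Lemma ipBl a b z : ip (a - b) z = ip a z - ip b z.
Proof. exact: linearBl. Qed.

Lemma ipBr z a b : ip z (a - b) = ip z a - ip z b.
Proof. exact: linearBr. Qed.

Lemma ip_suml (I : Type) (r : seq I) (P : pred I) (F : I -> H) z :
  ip (\sum_(i <- r | P i) F i) z = \sum_(i <- r | P i) ip (F i) z.
Proof. exact: linear_sumlz. Qed.

Lemma ip_sumr (I : Type) (r : seq I) (P : pred I) (F : I -> H) z :
  ip z (\sum_(i <- r | P i) F i) = \sum_(i <- r | P i) ip z (F i).
Proof. exact: linear_sumr. Qed.

Lemma ip_norm_sub w z : `|w - z| ^+ 2 = `|w| ^+ 2 - 2 * ip w z + `|z| ^+ 2.
Proof.
rewrite -!hip ipBl !ipBr (ipC z w); ring.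
Qed.

Lemma cauchy_schwarz w z : `|ip w z| <= `|w| * `|z|.
Proof.
have [->|z0] := eqVneq z 0; first by rewrite linear0r !normr0 mulr0.
have nz : 0 < `|z| by rewrite normr_gt0.
rewrite -(@ler_pXn2r _ 2) ?nnegrE ?mulr_ge0 // real_normK ?num_real //.
have := sqr_ge0 `|w - (ip w z / `|z| ^+ 2) *: z|.
rewrite ip_norm_sub normrZ exprMn real_normK ?num_real // ipZr.
set p := ip w z; set N := `|z| in nz *.
have -> : `|w| ^+ 2 - 2 * (p / N ^+ 2 * p) + (p / N ^+ 2) ^+ 2 * N ^+ 2
  = (`|w| ^+ 2 * N ^+ 2 - p ^+ 2) / N ^+ 2 by field; rewrite gt_eqF.
by rewrite pmulr_lge0 ?invr_gt0 ?exprn_gt0 // subr_ge0 exprMn.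
Qed.

Lemma cvg_ip (w : H) (z_ : nat -> H) z :
  z_ @ \oo --> z -> (fun k => ip (z_ k) w) @ \oo --> ip z w.
Proof.
move=> zz; apply/cvgrPdist_le => e e0.
have e1 : 0 < e / (`|w| + 1) by rewrite divr_gt0 // ltr_wpDl.
move/cvgrPdist_le : zz => /(_ _ e1).
apply: filterS => k; rewrite ler_pdivlMr ?ltr_wpDl // => zk.
rewrite -ipBl; apply: le_trans (cauchy_schwarz _ _) _.
by apply: le_trans zk; rewrite ler_wpM2l // lerDl.
Qed.

Section orthonormal_family.
Context (I : eqType) (J : set I) (e : I -> H) (he : orthonormal_on ip J e).
Context (P : pred I) (hP : forall i, P i -> J i).

Lemma ip_orthonormal_sum (a : I -> R) r i : uniq r -> J i ->
  ip (\sum_(j <- r | P j) a j *: e j) (e i) =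
  if (i \in r) && P i then a i else 0.
Proof.
move=> ur Ji; rewrite ip_suml.
under eq_bigr => j Pj do rewrite ipZl (he (hP Pj) Ji).
case: ifP => [/andP[ir Pi]|]; last first.
  move=> /negbT nir; rewrite big_seq_cond big1 // => j /andP[jr Pj].
  by have [ji|] := eqVneq j i; [move: nir; rewrite -ji jr Pj|rewrite mulr0].
rewrite big_mkcond (bigD1_seq i) //= Pi eqxx mulr1 big1 ?addr0 // => j ji.
by case: ifP => //; rewrite (negbTE ji) mulr0.
Qed.

Lemma norm_orthonormal_sum (a : I -> R) r : uniq r ->
  `|\sum_(j <- r | P j) a j *: e j| ^+ 2 = \sum_(j <- r | P j) a j ^+ 2.
Proof.
move=> ur; rewrite -hip ip_sumr big_seq_cond [RHS]big_seq_cond.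
apply: eq_bigr => j /andP[jr Pj].
by rewrite ipZr (ip_orthonormal_sum _ ur (hP Pj)) jr Pj expr2.
Qed.

(** Pythagoras: the residual of a partial Fourier expansion is orthogonal to it. *)
Lemma norm_orthonormal_residual w r : uniq r ->
  `|w - \sum_(j <- r | P j) ip w (e j) *: e j| ^+ 2 =
  `|w| ^+ 2 - \sum_(j <- r | P j) ip w (e j) ^+ 2.
Proof.
move=> ur; rewrite ip_norm_sub norm_orthonormal_sum // ip_sumr.
under eq_bigr do rewrite ipZr -expr2; ring.
Qed.

Lemma bessel w r : uniq r ->
  \sum_(j <- r | P j) ip w (e j) ^+ 2 <= `|w| ^+ 2.
Proof.
move=> ur; rewrite -subr_ge0 -norm_orthonormal_residual //; exact: sqr_ge0.
Qed.

End orthonormal_family.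
End real_hilbert_space.

(** * The Moore-Penrose inverse from a singular system *)

Section orthonormal_expansion.
Context (R : realType) (H : completeNormedModType R).
Context (ip : {dot H for idfun}) (hip : inner_product ip).
Context (J : set nat) (e : nat -> H) (he : orthonormal_on ip J e).

(** The coefficients of a convergent orthonormal series are read off by pairing,
    since each paired partial sum is constant from some rank on. *)
Lemma ip_series_orthonormal (a : nat -> R) z j : J j ->
  series (fun k => if k \in J then a k *: e k else 0) @ \oo --> z ->
  ip z (e j) = a j.
Proof.
move=> Jj az; have az' := cvg_ip hip (w := e j) az; apply: (cvg_unique _ az') => //.
apply: cvg_near_cst; near=> n.
rewrite /series /= -big_mkcond /=.
rewrite (ip_orthonormal_sum he _ a (iota_uniq _ _) Jj); last by move=> i /set_mem.
rewrite (mem_set Jj) mem_index_iota leq0n andbT /= ifT //.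
by near: n; exists j.+1.
Unshelve. all: by end_near. Qed.

(** The partial sums are Cauchy because, by Pythagoras, those of the squared
    coefficients are, which Bessel's inequality bounds. *)
Lemma is_cvg_fourier_series w :
  cvgn (series (fun j => if j \in J then ip w (e j) *: e j else 0)).
Proof.
have JP : forall i, i \in J -> J i by move=> i /set_mem.
pose sq j := if j \in J then ip w (e j) ^+ 2 else 0.
have csq : cvgn (series sq).
  apply: nondecreasing_is_cvgn.
    apply: nondecreasing_series => k _ _.
    by rewrite /sq; case: ifP => // _; exact: sqr_ge0.
  exists (`|w| ^+ 2) => _ [n _ <-].
  by rewrite /series /= -big_mkcond (bessel hip he JP) ?iota_uniq.
apply/cauchy_cvgP/cauchy_seriesP => eps eps0.
move/cauchy_cvgP/cauchy_seriesP : csq => /(_ _ (exprn_gt0 2 eps0)).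
apply: filterS => -[m n] /= mn.
rewrite -(@ltr_pXn2r _ 2) ?nnegrE ?(ltW eps0) //.
rewrite -big_mkcond (norm_orthonormal_sum hip he JP) ?iota_uniq //.
by rewrite big_mkcond; apply: le_lt_trans mn; exact: ler_norm.
Qed.

End orthonormal_expansion.

Section moore_penrose_inverse.
Context (R : realType) (H1 H2 : completeNormedModType R).
Context (ip1 : {dot H1 for idfun}) (hip1 : inner_product ip1).
Context (ip2 : {dot H2 for idfun}) (hip2 : inner_product ip2).
Context (A : {linear H1 -> H2}).
Context (J : set nat) (sigma : nat -> R) (u : nat -> H2) (v : nat -> H1).
Context (hsvd : singular_system ip1 ip2 A J sigma u v).

(** The singular system supplies the pseudoinverse of [A w] without a projection
    theorem: it is the expansion [sum_j <w, v_j> v_j], which has the same image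
    as [w] because [A] only sees the coefficients, and is orthogonal to [N(A)]
    because every [z] in [N(A)] has coefficients [sigma_j^-1 <A z, u_j> = 0]. *)
Lemma moore_penroseP g : range A g ->
  is_moore_penrose ip1 ip2 A g (moore_penrose ip1 ip2 A g).
Proof.
move=> [w _ <-]; case: hsvd => _ sigma_gt0 _ [hu hv] hA.
suff [f hf] : exists f, is_moore_penrose ip1 ip2 A (A w) f.
  by rewrite /moore_penrose; apply: (@xgetPex _ 0 _); exists f.
have c := is_cvg_fourier_series hip1 hv (w := w).
set f := limn (series _) in c.
have fv j : J j -> ip1 f (v j) = ip1 w (v j).
  by move=> Jj; rewrite (ip_series_orthonormal hip1 hv Jj c).
exists f; split.
  move=> z /= Az0.
  have zv j : J j -> ip1 z (v j) = 0.
    move=> Jj; have Az : series (fun j => if j \in J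
        then (sigma j * ip1 z (v j)) *: u j else 0) @ \oo --> A z by exact: hA.
    have := ip_series_orthonormal hip2 hu Jj Az.
    rewrite Az0 linear0l => /esym/eqP.
    by rewrite mulf_eq0 gt_eqF ?sigma_gt0 //= => /eqP.
  apply: (cvg_unique _ (cvg_ip hip1 (w := z) c)) => //.
  apply: cvg_near_cst; near=> n.
  rewrite /series /= -big_mkcond /= ip_suml big1 // => j /set_mem Jj.
  by rewrite ipZl ipC zv // mulr0.
have -> : A f = A w.
  apply: (cvg_unique _ (hA f)) => //.
  rewrite (_ : (fun j => _) = fun j => if j \in J
    then (sigma j * ip1 w (v j)) *: u j else 0); first exact: hA.
  apply/funext => j.
  by case: ifPn => // /set_mem Jj; rewrite fv.
by rewrite subrr => z _; rewrite linear0l.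
Unshelve. all: by end_near. Qed.

Lemma A_moore_penrose g : range A g -> A (moore_penrose ip1 ip2 A g) = g.
Proof.
move=> rg; have [_ orth] := moore_penroseP rg.
case: rg orth => w _ <-; set f := moore_penrose _ _ _ _ => orth.
have /eqP := orth (A (w - f)) (imageT _ _).
by rewrite -linearB hip2 sqrf_eq0 normr_eq0 linearB subr_eq0 => /eqP.
Qed.

Lemma HK_normE g : HK_norm ip1 ip2 A g = `|moore_penrose ip1 ip2 A g|.
Proof. by rewrite /HK_norm /HK_inner hip1 sqrtr_sqr normr_id. Qed.

(** [A^+ A] is the orthogonal projection onto [N(A)^perp], a contraction. *)
Lemma HK_norm_le z : HK_norm ip1 ip2 A (A z) <= `|z|.
Proof.
have rAz : range A (A z) by exact: imageT.
have [orth _] := moore_penroseP rAz; have Af := A_moore_penrose rAz.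
rewrite HK_normE; set f := moore_penrose _ _ _ _ in orth Af *.
(* z - f lies in N(A), so <f, z> = |f|^2, and Cauchy-Schwarz applies. *)
have := orth (z - f); rewrite /= linearB Af subrr => /(_ erefl) /eqP.
rewrite ipBr subr_eq0 hip1 => /eqP fz.
have [->|f0] := eqVneq f 0; first by rewrite normr0.
rewrite -(ler_pM2l (x := `|f|)) ?normr_gt0 // -expr2 -fz.
exact: le_trans (ler_norm _) (cauchy_schwarz hip1 _ _).
Qed.

End moore_penrose_inverse.

(** * Spectral calculus *)

Section functional_calculus.
Context (R : realType) (H : completeNormedModType R).
Context (ip : {dot H for idfun}) (hip : inner_product ip).
Context (m : nat) (e : 'I_m -> H) (he : orthonormal_on ip setT e).
Context (t : 'I_m -> R).
Implicit Types (r : R -> R) (w z : H).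

(** [r(T)] for the operator [T] with orthonormal eigenvectors [e] and eigenvalues
    [t] that vanishes on the orthogonal complement of [e]. *)
Definition spectral_fun r w : H :=
  \sum_(i < m) (r (t i) * ip w (e i)) *: e i
  + r 0 *: (w - \sum_(i < m) ip w (e i) *: e i).

Let uniqI : uniq (index_enum 'I_m). Proof. exact: index_enum_uniq. Qed.

Let inT (i : 'I_m) : true -> [set: 'I_m] i. Proof. by []. Qed.

Let coef (a : 'I_m -> R) i : ip (\sum_(j < m) a j *: e j) (e i) = a i.
Proof. by rewrite (ip_orthonormal_sum he inT a uniqI I) mem_index_enum. Qed.

Lemma ip_spectral_fun r w i : ip (spectral_fun r w) (e i) = r (t i) * ip w (e i).
Proof.
by rewrite /spectral_fun linearDl /= coef ipZl ipBl coef subrr mulr0 addr0.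
Qed.

Lemma spectral_fun_residual r w :
  spectral_fun r w - \sum_(i < m) ip (spectral_fun r w) (e i) *: e i =
  r 0 *: (w - \sum_(i < m) ip w (e i) *: e i).
Proof.
under eq_bigr do rewrite ip_spectral_fun.
by rewrite /spectral_fun addrAC subrr add0r.
Qed.

(** Multiplicativity of the calculus: [spectral_fun] keeps the decomposition of
    [w] into coefficients and a residual, and scales each part. *)
Lemma spectral_fun_comp r1 r2 w :
  spectral_fun r1 (spectral_fun r2 w) = spectral_fun (fun l => r1 l * r2 l) w.
Proof.
rewrite {1}/spectral_fun spectral_fun_residual scalerA [in RHS]/spectral_fun.
by congr (_ + _); apply: eq_bigr => i _; rewrite ip_spectral_fun mulrA.
Qed.

Lemma spectral_fun_one_sub r w :
  spectral_fun (fun l => 1 - r l) w = w - spectral_fun r w.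
Proof.
rewrite /spectral_fun scalerBl scale1r.
under eq_bigr do rewrite mulrBl mul1r scalerBl.
by rewrite sumrB addrA [_ + (w - _)]addrC addrA subrK opprD addrA.
Qed.

Lemma spectral_fun_sym r w z :
  ip (spectral_fun r w) z = ip w (spectral_fun r z).
Proof.
rewrite /spectral_fun linearDl linearDr /= ipZl ipZr ipBl ipBr !ip_suml !ip_sumr.
congr (_ + _ * (_ - _)); apply: eq_bigr => i _; rewrite !ipZl !ipZr (ipC _ z); ring.
Qed.

(** Parseval: [r(T) w] has coefficients [r (t i) * <w, e i>] on the eigenvectors
    and is [r 0] times the identity on their orthogonal complement. *)
Lemma norm_spectral_fun r w M : 0 <= M ->
  (forall i, `|r (t i)| <= M) -> `|r 0| <= M -> `|spectral_fun r w| <= M * `|w|.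
Proof.
move=> M0 Mt Mr0; rewrite -(@ler_pXn2r _ 2) ?nnegrE ?mulr_ge0 // exprMn.
have sqM x : `|x| <= M -> x ^+ 2 <= M ^+ 2.
  by move=> xM; rewrite -(real_normK (num_real x)) lerXn2r ?nnegrE.
have := norm_orthonormal_residual hip he inT (spectral_fun r w) uniqI.
rewrite spectral_fun_residual normrZ exprMn (norm_orthonormal_residual hip he inT) //.
under [X in _ = _ - X]eq_bigr do rewrite ip_spectral_fun exprMn.
move/eqP; rewrite eq_sym subr_eq => /eqP ->.
rewrite -[leRHS](subrK (M ^+ 2 * \sum_(i < m) ip w (e i) ^+ 2)) -mulrBr mulr_sumr.
apply: lerD; last by apply: ler_sum => i _; rewrite ler_wpM2r ?sqr_ge0 // sqM.
rewrite ler_wpM2r ?subr_ge0 ?(bessel hip he inT) //.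
by rewrite real_normK ?num_real // sqM.
Qed.

Lemma ip_spectral_fun_le r w M : 0 <= M ->
  (forall i, `|r (t i)| <= M) -> `|r 0| <= M ->
  ip (spectral_fun r w) w <= M * `|w| ^+ 2.
Proof.
move=> M0 Mt Mr0; apply: le_trans (ler_norm _) _.
apply: le_trans (cauchy_schwarz hip _ _) _.
by rewrite expr2 mulrA ler_wpM2r ?norm_spectral_fun.
Qed.

End functional_calculus.

(** * The sampling operator *)

Section sampling_operator.
Context (R : realType) (d : nat) (H : completeNormedModType R).
Context (ip : {dot H for idfun}) (hip : inner_product ip).
Context (phi : 'rV[R]_d -> H) (n : nat) (hn : (0 < n)%N).
Context (x : 'I_n -> 'rV[R]_d).
Local Notation An := (sampling_op ip phi x).
Local Notation T := (sampling_normal_op ip phi x).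

Lemma ip_sampling_adj w z :
  ip z (sampling_adj phi x w) = n%:R^-1 * \sum_(i < n) w 0 i * ip z (phi (x i)).
Proof.
by rewrite ipZr ip_sumr; under eq_bigr do rewrite ipZr.
Qed.

Lemma sqr_nnorm_sampling_op w : nnorm (An w) ^+ 2 = ip (T w) w.
Proof.
rewrite ipC ip_sampling_adj sqr_sqrtr; last first.
  by rewrite mulr_ge0 ?invr_ge0 ?ler0n // sumr_ge0 // => i _; exact: sqr_ge0.
by congr (_ * _); apply: eq_bigr => i _; rewrite !mxE -expr2.
Qed.

Lemma nnorm_ge0 (y : 'rV[R]_n) : 0 <= nnorm y.
Proof. exact: sqrtr_ge0. Qed.

Lemma nnorm_le_max (y : 'rV[R]_n) M : 0 <= M -> (forall i, `|y 0 i| <= M) ->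
  nnorm y <= M.
Proof.
move=> M0 yM; rewrite -[M]ger0_norm // -sqrtr_sqr ler_wsqrtr //.
rewrite ler_pdivrMl ?ltr0n //.
have -> : n%:R * M ^+ 2 = \sum_(i < n) M ^+ 2.
  by rewrite sumr_const card_ord mulr_natl.
apply: ler_sum => i _; rewrite -(real_normK (num_real (y 0 i))).
by rewrite lerXn2r ?nnegrE.
Qed.

Lemma nnorm_sampling_op_le c w : (forall i, `|phi (x i)| <= c) ->
  nnorm (An w) <= c * `|w|.
Proof.
move=> phic; have c0 : 0 <= c := le_trans (normr_ge0 _) (phic (Ordinal hn)).
apply: nnorm_le_max => [|i]; first by rewrite mulr_ge0.
rewrite mxE mulrC; apply: le_trans (cauchy_schwarz hip _ _) _.
by rewrite ler_wpM2l.
Qed.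

Lemma nnorm_sampling_opZ a w : nnorm (An (a *: w)) ^+ 2 = a ^+ 2 * nnorm (An w) ^+ 2.
Proof.
rewrite !sqr_nnorm_sampling_op ![ip (T _) _]ipC !ip_sampling_adj mulrCA.
congr (_ * _); rewrite mulr_sumr; apply: eq_bigr => i _; rewrite !mxE ipZl; ring.
Qed.

Lemma nnorm_sampling_opnorm c w : (forall i, `|phi (x i)| <= c) -> `|w| <= 1 ->
  nnorm (An w) <= sampling_opnorm ip phi x.
Proof.
move=> phic w1; apply: ub_le_sup; last by exists w.
exists c => _ [z /= z1 <-]; apply: le_trans (nnorm_sampling_op_le _ phic) _.
have c0 : 0 <= c := le_trans (normr_ge0 _) (phic (Ordinal hn)).
by rewrite ler_piMr.
Qed.

(** The eigenvalue of [e i] is [<T (e i), e i> = |A_n (e i)|^2].  This is what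
    confines the calculus to the interval on which the regularization family is
    controlled. *)
Lemma sampling_eigenvalue c m (e : 'I_m -> H) (t : 'I_m -> R) i :
  (forall j, `|phi (x j)| <= c) -> orthonormal_on ip setT e ->
  (forall w, T w = \sum_(i < m) (t i * ip w (e i)) *: e i) ->
  0 <= t i <= sampling_opnorm ip phi x ^+ 2.
Proof.
move=> phic he hT.
have ei : `|e i| = 1.
  by apply/eqP; rewrite -sqrp_eq1 // -hip he ?eqxx.
have -> : t i = nnorm (An (e i)) ^+ 2.
  rewrite sqr_nnorm_sampling_op hT.
  rewrite (@ip_orthonormal_sum _ _ _ _ setT) ?index_enum_uniq //.
  by rewrite mem_index_enum he // eqxx mulr1.
rewrite sqr_ge0 lerXn2r ?nnegrE ?nnorm_ge0 //; last first.
  by apply: nnorm_sampling_opnorm phic _; rewrite ei.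
apply: le_trans (nnorm_ge0 (An (e i))) _.
by apply: nnorm_sampling_opnorm phic _; rewrite ei.
Qed.

(** [|A_n w|^2 = <T w, w>] is at most the trace norm of [T] for a unit vector
    [w]: test the trace norm on the one-element orthonormal system [w]. *)
Lemma nnorm_sampling_trace C2 w : 0 <= C2 ->
  (n%:R%:E * trace_norm ip T <= (C2 ^+ 2)%:E)%E ->
  nnorm (An w) <= C2 / Num.sqrt n%:R * `|w|.
Proof.
move=> C20 htr.
have sn : 0 < Num.sqrt n%:R :> R by rewrite sqrtr_gt0 ltr0n.
have [->|w0] := eqVneq w 0.
  rewrite normr0 mulr0; apply: nnorm_le_max => // i.
  by rewrite mxE linear0l normr0.
have nw : 0 < `|w| by rewrite normr_gt0.
pose w' := `|w|^-1 *: w.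
have nw' : `|w'| = 1.
  by rewrite normrZ ger0_norm ?invr_ge0 // mulVf // gt_eqF.
have tw : (`|ip (T w') w'|%:E <= trace_norm ip T)%E.
  apply: ereal_sup_ubound; exists 1%N, (fun=> w'), (fun=> w').
  have o : orthonormal_on ip [set: 'I_1] (fun=> w').
    by move=> i j _ _; rewrite hip nw' !ord1 eqxx expr1n.
  by split=> //; rewrite big_ord1.
have : (n%:R%:E * `|ip (T w') w'|%:E <= (C2 ^+ 2)%:E)%E.
  by apply: le_trans htr; apply: lee_wpmul2l; rewrite // lee_fin.
rewrite -EFinM lee_fin -sqr_nnorm_sampling_op ger0_norm ?sqr_ge0 //.
rewrite nnorm_sampling_opZ; have := nnorm_ge0 (An w).
move: (nnorm _) => y y0 hw.
rewrite -(@ler_pXn2r _ 2) ?nnegrE ?mulr_ge0 ?invr_ge0 ?(ltW sn) //.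
rewrite !exprMn exprVn sqr_sqrtr ?ler0n // mulrAC ler_pdivlMr ?ltr0n //.
move: hw; rewrite exprVn mulrCA ler_pdivrMl ?exprn_gt0 //.
by rewrite mulrC [X in _ <= X -> _]mulrC.
Qed.

End sampling_operator.

(** * Sobolev norms and pointwise bounds *)

Section sobolev_seminorm.
Context (R : realType) (d : nat).

Lemma sqr_L2_ge0 (O : set 'rV[R]_d) w : (0 <= sqr_L2 O w)%E.
Proof. by apply: integral_ge0 => y _; rewrite lee_fin sqr_ge0. Qed.

Lemma sqr_slobodeckij_ge0 (O : set 'rV[R]_d) s w : (0 <= sqr_slobodeckij O s w)%E.
Proof.
apply: integral_ge0 => y _; apply: integral_ge0 => y' _.
by rewrite lee_fin divr_ge0 ?sqr_ge0 ?powR_ge0.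
Qed.

Lemma sqr_sobolev_seminorm_ge0 (O : set 'rV[R]_d) tau z :
  (0 <= sqr_sobolev_seminorm O tau z)%E.
Proof.
apply: sume_ge0 => a _.
by case: ifP => _; [exact: sqr_L2_ge0|exact: sqr_slobodeckij_ge0].
Qed.

(** For integral [tau] the seminorm collects the top-order terms of the norm; for
    fractional [tau] it is the last summand of the norm. *)
Lemma sobolev_seminorm_le (X : set 'rV[R]_d) tau z : sobolev X tau z ->
  sobolev_seminorm X tau z <= sobolev_norm X tau z.
Proof.
case=> _ _ zoo; apply: ler_wsqrtr.
have le : (sqr_sobolev_seminorm X° tau z <= sqr_sobolev_norm X° tau z)%E.
  rewrite /sqr_sobolev_norm; case: (eqVneq (frac_part tau) 0) => [tau0|_].
    rewrite adde0 /sqr_sobolev_seminorm tau0 eqxx.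
    rewrite big_mkcond [leRHS]big_mkcond; apply: lee_sum => a _.
    case: eqP => [->|_]; first by rewrite leqnn.
    by case: ifP => // _; exact: sqr_L2_ge0.
  by rewrite leeDr // sume_ge0 // => a _; exact: sqr_L2_ge0.
rewrite fine_le // ge0_fin_numE ?sqr_sobolev_seminorm_ge0 //.
- exact: le_lt_trans le zoo.
- exact: le_trans (sqr_sobolev_seminorm_ge0 _ _ _) le.
Qed.

Lemma sampling_inequality_pointwise (X : set 'rV[R]_d) tau C h0 designs n
    (x : 'I_n -> 'rV[R]_d) z y : sampling_inequality X tau C h0 designs ->
  (0 < n)%N -> @designs n x -> (forall i, X (x i)) -> fill_distance X x <= h0 ->
  sobolev X tau z -> X y ->
  `|z y| <= C * (fill_distance X x `^ (tau - d%:R / 2) * sobolev_seminorm X tau z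
                 + nnorm (\row_(i < n) z (x i))).
Proof.
move=> hs hn dx Xx hx sz Xy; rewrite -lee_fin.
by apply: le_trans (hs n x hn dx Xx hx z sz); apply: ereal_sup_ubound; exists y.
Qed.

End sobolev_seminorm.

(** * Test functions *)

Section test_functions.
Context (R : realType) (d : nat) (X : set 'rV[R]_d) (H : completeNormedModType R).
Context (ip : {dot H for idfun}) (hip : inner_product ip).
Context (phi : 'rV[R]_d -> H) (alpha : nat -> R) (psi : H).
Context (hpsi : in_A1 X phi alpha psi).

Lemma l1_norm_ge0 : 0 <= l1_norm alpha.
Proof.
case: hpsi => xi [_ ca _]; apply: limr_ge => //.
by apply: nearW => k; rewrite /series /= sumr_ge0.
Qed.

Lemma ip_test_function_le z M : (forall y, X y -> `|ip (phi y) z| <= M) ->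
  `|ip psi z| <= l1_norm alpha * M.
Proof.
case: hpsi => xi [Xxi ca cpsi] zM.
have M0 : 0 <= M := le_trans (normr_ge0 _) (zM _ (Xxi 0)).
have cz : (fun k => `|ip (series (fun i => alpha i *: phi (xi i)) k) z|) @ \oo
    --> `|ip psi z| by apply: cvg_norm; exact: (cvg_ip hip cpsi).
rewrite -(cvg_lim (@Rhausdorff R) cz); apply: limr_le.
  by apply/cvg_ex; exists (`|ip psi z|).
apply: nearW => k; rewrite /series /= ip_suml.
apply: le_trans (ler_norm_sum _ _ _) _.
have -> : l1_norm alpha * M = M * l1_norm alpha by rewrite mulrC.
have sl : series (fun i => `|alpha i|) k <= l1_norm alpha.
  apply: nondecreasing_cvgn_le => //; apply: nondecreasing_series => i _ _.
  exact: normr_ge0.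
apply: le_trans (ler_wpM2l M0 sl); rewrite /series /= mulr_sumr.
by apply: ler_sum => i _; rewrite ipZl normrM mulrC ler_wpM2r // zM.
Qed.

Lemma norm_test_function_le c : (forall y, X y -> `|phi y| <= c) ->
  `|psi| <= c * l1_norm alpha.
Proof.
move=> phic; have [->|psi0] := eqVneq psi 0.
  case: hpsi => xi [Xxi _ _]; rewrite normr0 mulr_ge0 ?l1_norm_ge0 //.
  exact: le_trans (normr_ge0 _) (phic _ (Xxi 0)).
have := @ip_test_function_le psi (c * `|psi|).
rewrite hip ger0_norm ?sqr_ge0 // expr2 mulrCA mulrA ler_pM2r ?normr_gt0 //.
apply=> y Xy; apply: le_trans (cauchy_schwarz hip _ _) _.
by rewrite ler_wpM2r // phic.
Qed.

End test_functions.

(** * Moments of the normal law *)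

Section normal_moments.
Context (R : realType).
Local Notation mu := (@lebesgue_measure R).
Implicit Types (s m x : R).

(** By uniqueness of the Radon-Nikodym derivative, the density of the normal law
    is its derivative with respect to Lebesgue measure. *)
Lemma ge0_integral_normal_prob m s (f : R -> \bar R) :
  measurable_fun [set: R] f -> (forall x, 0 <= f x)%E ->
  (\int[normal_prob m s]_x f x = \int[mu]_x (f x * (normal_pdf m s x)%:E))%E.
Proof.
move=> mf f0; pose dom := normal_prob_dominates m s.
have mpdf : measurable_fun setT (fun x => (normal_pdf m s x)%:E).
  by apply/measurable_EFinP; exact: measurable_normal_pdf.
rewrite -(Radon_Nikodym_SigmaFinite.change_of_variables dom) //.
have mRN := measurable_int _ (Radon_Nikodym_SigmaFinite.f_integrable dom).
apply: ae_eq_integral => //; [exact: emeasurable_funM|exact: emeasurable_funM|].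
apply: ae_eqe_mul2l; apply: integral_ae_eq => //.
  exact: Radon_Nikodym_SigmaFinite.f_integrable.
by move=> B _ mB; rewrite -Radon_Nikodym_SigmaFinite.f_integral.
Qed.

(** A Gaussian weight turns a centred normal density into a multiple of one of
    another width. *)
Lemma normal_pdf_dilate s r x : 0 < s -> 0 < r ->
  expR (x ^+ 2 * ((1 - r ^- 2) / (2 * s ^+ 2))) * normal_pdf 0 s x =
  r * normal_pdf 0 (s * r) x.
Proof.
move=> s0 r0; rewrite !normal_pdfE ?gt_eqF ?mulr_gt0 //.
rewrite /normal_peak /normal_fun mulrCA -expRD.
have -> : Num.sqrt ((s * r) ^+ 2 * pi *+ 2) = r * Num.sqrt (s ^+ 2 * pi *+ 2).
  rewrite -{2}[r]gtr0_norm // -sqrtr_sqr -sqrtrM ?sqr_ge0 //.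
  by congr Num.sqrt; ring.
rewrite [RHS]mulrA [(r * Num.sqrt _)^-1]invfM [r * (_ / _)]mulrA divff ?gt_eqF //.
rewrite mul1r; congr (_ * expR _).
by field; rewrite !gt_eqF.
Qed.

(** An exponential weight turns a centred normal density into a multiple of a
    shifted one; this gives the moment generating function. *)
Lemma normal_pdf_translate s e x : 0 < s ->
  expR (e * x) * normal_pdf 0 s x =
  expR (e ^+ 2 * s ^+ 2 / 2) * normal_pdf (e * s ^+ 2) s x.
Proof.
move=> s0; rewrite !normal_pdfE ?gt_eqF //.
rewrite /normal_fun mulrCA -expRD [RHS]mulrCA -expRD; congr (_ * expR _).
by field; rewrite gt_eqF.
Qed.

(** Since [1 + k x^2 <= exp (k x^2)], dilating the density by [r > 1] gives
    [1 + k I <= r] for the second moment [I], with [k = (1 - r^-2) / (2 s^2)].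
    Thus [I <= 2 s^2 r^2 / (r + 1) <= s^2 r^2], and [r] tends to 1. *)
Lemma normal_second_moment_le s : 0 < s ->
  (\int[normal_prob 0 s]_x (x ^+ 2)%:E <= (s ^+ 2)%:E)%E.
Proof.
move=> s0; apply/lee_addgt0Pr => eps eps0.
(* This r makes s^2 r^2 equal to s^2 + eps. *)
pose r := Num.sqrt (1 + eps / s ^+ 2).
have s20 : 0 < s ^+ 2 by rewrite exprn_gt0.
have r2 : r ^+ 2 = 1 + eps / s ^+ 2.
  by rewrite sqr_sqrtr // addr_ge0 // divr_ge0 // ltW.
have r1 : 1 < r.
  rewrite -[1]sqrtr1 ltr_sqrt ?ltrDl ?divr_gt0 // ltr_wpDl // divr_gt0 //.
have r0 : 0 < r by exact: lt_trans r1.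
pose k := (1 - r ^- 2) / (2 * s ^+ 2).
have k0 : 0 < k.
  by rewrite divr_gt0 ?mulr_gt0 // subr_gt0 invf_lt1 ?exprn_gt0 // exprn_egt1.
pose I := (\int[normal_prob 0 s]_x (x ^+ 2)%:E)%E.
have mx2 : measurable_fun [set: R] (fun x => (x ^+ 2)%:E).
  by apply/measurable_EFinP; exact: measurable_funX.
have key : (1 + k%:E * I <= r%:E)%E.
  have -> : 1%E = (\int[normal_prob 0 s]_x (cst 1 x))%E :> \bar R.
    by rewrite integral_cst // mul1e; exact/esym/integral_normal_pdf.
  rewrite -ge0_integralZl //; last 2 first.
    by move=> x _; rewrite lee_fin sqr_ge0.
    by rewrite lee_fin ltW.
  rewrite -ge0_integralD //; last 2 first.
    by move=> x _; rewrite mule_ge0 // lee_fin ?sqr_ge0 // ltW.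
    by apply: measurable_funeM.
  rewrite ge0_integral_normal_prob; last 2 first.
    by apply: emeasurable_funD => //; exact: measurable_funeM.
    by move=> x; rewrite adde_ge0 // mule_ge0 // lee_fin ?sqr_ge0 // ltW.
  have -> : r%:E = (\int[mu]_x (r%:E * (normal_pdf 0 (s * r) x)%:E))%E.
    rewrite ge0_integralZl ?integral_normal_pdf ?mule1 ?lee_fin ?ltW //.
      by apply/measurable_EFinP; exact: measurable_normal_pdf.
    by move=> x _; rewrite lee_fin normal_pdf_ge0.
  apply: ge0_le_integral => //.
  - move=> x _; apply: mule_ge0; last by rewrite lee_fin normal_pdf_ge0.
    by rewrite adde_ge0 // mule_ge0 // lee_fin ?sqr_ge0 // ltW.
  - apply: emeasurable_funM.
      by apply: emeasurable_funD => //; exact: measurable_funeM.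
    by apply/measurable_EFinP; exact: measurable_normal_pdf.
  - by apply: measurable_funeM; apply/measurable_EFinP; exact: measurable_normal_pdf.
  move=> x _; rewrite -!EFinM lee_fin -normal_pdf_dilate // ler_wpM2r ?normal_pdf_ge0 //.
  by rewrite [k * _]mulrC expR_ge1Dx.
have I0 : (0 <= I)%E by apply: integral_ge0 => x _; rewrite lee_fin sqr_ge0.
move: key I0; rewrite -/I; case: I => [I||] //; last first.
  by rewrite gt0_muley ?lte_fin // addey.
rewrite -EFinM -EFinD !lee_fin => key I0.
have : k * I <= r - 1 by rewrite lerBrDl.
rewrite -ler_pdivlMl // => /le_trans; apply.
have -> : k^-1 * (r - 1) = 2 * s ^+ 2 * r ^+ 2 / (r + 1).
  by rewrite /k; field; rewrite !gt_eqF ?subr_gt0 ?exprn_egt1 ?addr_gt0.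
have <- : s ^+ 2 * r ^+ 2 = s ^+ 2 + eps.
  by rewrite r2 mulrDr mulr1 mulrCA divff ?mulr1 // gt_eqF.
rewrite ler_pdivrMr ?addr_gt0 // [leRHS]mulrC -!mulrA.
by rewrite ler_wpM2r ?mulr_ge0 ?sqr_ge0 //; lra.
Qed.

Lemma integrable_normal_id s : 0 < s ->
  (normal_prob 0 s).-integrable [set: R] (EFin \o (fun x : R => x)).
Proof.
move=> s0; apply/integrableP; split; first exact/measurable_EFinP.
have m1 : measurable_fun [set: R] (fun x => (1 + x ^+ 2)%:E).
  by apply/measurable_EFinP; apply: measurable_funD => //; exact: measurable_funX.
apply: (@le_lt_trans _ _ (\int[normal_prob 0 s]_x (1 + x ^+ 2)%:E)%E).
  apply: ge0_le_integral => //.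
  - by apply/measurable_EFinP/measurableT_comp.
  - move=> x _; rewrite lee_fin -(real_normK (num_real x)).
    by have := sqr_ge0 (`|x| - 2^-1); nra.
under eq_integral do rewrite EFinD.
rewrite ge0_integralD //.
- rewrite integral_cst //= lte_add_pinfty
    ?(le_lt_trans (normal_second_moment_le s0)) ?ltry //.
  by rewrite mul1e [X in (X < _)%E]integral_normal_pdf ltry.
- by move=> x _; rewrite lee_fin sqr_ge0.
- by apply/measurable_EFinP; exact: measurable_funX.
Qed.

Lemma integral_expR_normal s e : 0 < s ->
  (\int[normal_prob 0 s]_x (expR (e * x))%:E
   = (expR (e ^+ 2 * s ^+ 2 / 2))%:E)%E.
Proof.
move=> s0; rewrite ge0_integral_normal_prob; last 2 first.
- by apply/measurable_EFinP; apply: measurableT_comp => //; exact: measurable_funM.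
- by move=> x; rewrite lee_fin expR_ge0.
under eq_integral do rewrite -EFinM normal_pdf_translate // EFinM.
rewrite ge0_integralZl ?integral_normal_pdf ?mule1 ?lee_fin ?expR_ge0 //.
  by apply/measurable_EFinP; exact: measurable_normal_pdf.
by move=> x _; rewrite lee_fin normal_pdf_ge0.
Qed.

(** From [1 + e x <= exp (e x)] the mean [M] satisfies
    [1 + e M <= exp (e^2 s^2 / 2)] for every real [e], of either sign; the right
    side is [1 + O(e^2)], which forces [M = 0]. *)
Lemma normal_mean s : 0 < s -> (\int[normal_prob 0 s]_x x%:E = 0)%E.
Proof.
move=> s0; have ii := integrable_normal_id s0.
have /fineK : (\int[normal_prob 0 s]_x x%:E)%E \is a fin_num.
  exact: integrable_fin_num ii.
set M := fine _ => MI.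
have s20 : 0 < s ^+ 2 by rewrite exprn_gt0.
have key e : 1 + e * M <= expR (e ^+ 2 * s ^+ 2 / 2).
  rewrite -lee_fin -integral_expR_normal // EFinD EFinM MI.
  have -> : 1%:E = (\int[normal_prob 0 s]_x (cst 1%E x))%E :> \bar R.
    by rewrite integral_cst // mul1e; exact/esym/integral_normal_pdf.
  rewrite -integralZl // -integralD //; last 2 first.
  - exact: finite_measure_integrable_cst.
  - exact: (integrableZl measurableT e ii).
  apply: le_integral => //.
  - by apply: integrableD => //; 
      [exact: finite_measure_integrable_cst|exact: (integrableZl measurableT e ii)].
  - apply/integrableP; split.
      by apply/measurable_EFinP; apply: measurableT_comp => //; exact: measurable_funM.
    under eq_integral do rewrite /= ger0_norm ?expR_ge0 //.
    by rewrite integral_expR_normal // ltry.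
  - by move=> x _; rewrite -EFinM -EFinD lee_fin expR_ge1Dx.
rewrite -MI; congr EFin; apply/eqP/negPn/negP => M0.
have M20 : 0 < M ^+ 2 by rewrite exprn_even_gt0.
(* e = t * M with t small enough for e^2 s^2 / 2 <= 1/2 and t s^2 < 1. *)
pose t := (1 + s ^+ 2 + M ^+ 2 * s ^+ 2)^-1.
have dt : 0 < 1 + s ^+ 2 + M ^+ 2 * s ^+ 2 by have := mulr_gt0 M20 s20; lra.
have t0 : 0 < t by rewrite invr_gt0.
have tE : t * (1 + s ^+ 2 + M ^+ 2 * s ^+ 2) = 1 by rewrite mulVf ?gt_eqF.
have t1 : t <= 1 by rewrite -tE ler_peMr ?ltW //; nra.
have := key (t * M); set w := (t * M) ^+ 2 * s ^+ 2 / 2 => le_exp.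
have exp_le : expR w * (1 - w) <= 1.
  rewrite -[leRHS](expRxMexpNx_1 w) ler_wpM2l ?expR_ge0 //.
  exact: expR_ge1Dx.
have wE : w = t ^+ 2 * (M ^+ 2 * s ^+ 2) / 2 by rewrite /w; ring.
have w12 : w <= 2^-1.
  rewrite wE; set k := M ^+ 2 * s ^+ 2 in tE *.
  have k0 : 0 <= k by rewrite mulr_ge0 ?ltW.
  have : t * k <= 1 by rewrite -tE ler_wpM2l ?ltW //; lra.
  by have := ltW t0; nra.
have w1 : 0 <= 1 - w by lra.
have := le_trans (ler_wpM2r w1 le_exp) exp_le.
have ts : t * s ^+ 2 < 1.
  by rewrite -[ltRHS]tE ltr_pM2l //; have := mulr_gt0 M20 s20; lra.
have -> : (1 + t * M * M) * (1 - w) = 1 + t * M ^+ 2 * (1 - w - t * s ^+ 2 / 2).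
  by rewrite wE; ring.
have q : 0 < 1 - w - t * s ^+ 2 / 2 by lra.
by rewrite gerDl leNgt (mulr_gt0 (mulr_gt0 t0 M20) q).
Qed.

End normal_moments.

(** * Independence and Gaussian noise *)

Section independent_product.
Context (R : realType) (d : measure_display) (T : measurableType d).
Context (P : probability T R) (X Y : {RV P >-> R}).
Context (indep : forall A B : set R, measurable A -> measurable B ->
  P (X @^-1` A `&` Y @^-1` B) = (P (X @^-1` A) * P (Y @^-1` B))%E).
Context (iX : P.-integrable setT (EFin \o X)) (iY : P.-integrable setT (EFin \o Y)).
Context (iXY : P.-integrable setT (EFin \o (X \* Y))).

Let Z (w : T) : R * R := (X w, Y w).

Let mZ : measurable_fun setT Z.
Proof. by apply: measurable_fun_pair. Qed.

HB.instance Definition _ := isMeasurableFun.Build _ _ _ _ Z mZ.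

Let h (p : R * R) : \bar R := (p.1 * p.2)%:E.

Let mh : measurable_fun setT h.
Proof. by apply/measurable_EFinP; exact: measurable_funM. Qed.

(** The joint law agrees with the product of the laws on rectangles, hence on all
    measurable sets. *)
Let product_law (S : set (R * R)) : measurable S ->
  (distribution P X \x distribution P Y)%E S =
  distribution P (Z : {RV P >-> (R * R)%type}) S.
Proof.
apply: product_measure_unique => A B mA mB /=; rewrite -indep //.
Qed.

Lemma integral_independent_product :
  (\int[P]_w (X w * Y w)%:E = (\int[P]_w (X w)%:E) * (\int[P]_w (Y w)%:E))%E.
Proof.
have law : forall f : R * R -> \bar R, (\int[distribution P X \x distribution P Y]_p f p
   = \int[distribution P (Z : {RV P >-> (R * R)%type})]_p f p)%E.
  by move=> f; apply: eq_measure_integral => A mA _; exact: product_law.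
have ih : (distribution P X \x distribution P Y)%E.-integrable setT h.
  apply/integrableP; split => //; rewrite law ge0_integral_distribution //.
    by case/integrableP : iXY.
  by apply: measurableT_comp.
have -> : (\int[P]_w (X w * Y w)%:E = \int[distribution P X \x distribution P Y]_p h p)%E.
  by rewrite law integral_distribution.
rewrite -integral12_prod_meas1 //.
have iid (V : {RV P >-> R}) : P.-integrable setT (EFin \o V) ->
    (distribution P V).-integrable setT (EFin \o (fun x : R => x)).
  by move=> iV; apply: integrable_pushforward => //; exact/measurable_EFinP.
have mean (V : {RV P >-> R}) : P.-integrable setT (EFin \o V) ->
    (\int[distribution P V]_x x%:E = \int[P]_w (V w)%:E)%E.
  by move=> iV; rewrite integral_distribution.
have /fineK EY := integrable_fin_num measurableT iY.
under eq_integral => x _.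
  rewrite /fubini_F /h; under eq_integral do rewrite EFinM.
  rewrite integralZl //; last exact: iid.
  rewrite mean // -EY muleC.
  over.
rewrite integralZl //; last exact: iid.
by rewrite mean // EY muleC.
Qed.

End independent_product.

Section gaussian_noise.
Context (R : realType) (dO : measure_display) (Omega : measurableType dO).
Context (P : probability Omega R) (nu : R) (hnu : 0 < nu).
Context (n : nat) (delta : 'I_n -> {RV P >-> R}) (hdelta : iid_gaussian nu delta).

(** The noise with values in [R] equipped with the structure that carries the
    normal law: the measurable sets are those of [R], but the displays differ. *)
Definition borel_noise i : Omega -> measurableTypeR R := delta i.

Let measurable_borel_noise i : measurable_fun setT (borel_noise i).
Proof.
move=> mT B mB; have mi : measurable_fun setT (delta i) by [].
exact: (mi measurableT B mB).
Qed.

HB.instance Definition _ i :=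
  isMeasurableFun.Build _ _ _ _ (borel_noise i) (@measurable_borel_noise i).

Let borel_noise_law i A : measurable A ->
  distribution P (borel_noise i : {RV P >-> measurableTypeR R}) A = normal_prob 0 nu A.
Proof. by move=> mA; case: hdelta => law _; exact: law. Qed.

Lemma ge0_expectation_gaussian i (f : R -> \bar R) :
  measurable_fun setT (f : measurableTypeR R -> \bar R) -> (forall x, 0 <= f x)%E ->
  (\int[P]_w f (delta i w) = \int[normal_prob 0 nu]_x f x)%E.
Proof.
move=> mf f0; have := ge0_integral_distribution (P := P) (borel_noise i) mf f0.
rewrite /comp => <-; apply: eq_measure_integral => A mA _.
exact: borel_noise_law.
Qed.

Lemma noise_second_moment_le i : (\int[P]_w (delta i w ^+ 2)%:E <= (nu ^+ 2)%:E)%E.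
Proof.
rewrite (@ge0_expectation_gaussian i (fun x => (x ^+ 2)%:E)).
- exact: normal_second_moment_le.
- by apply/measurable_EFinP; exact: measurable_funX.
- by move=> x; rewrite lee_fin sqr_ge0.
Qed.

Lemma integrable_noise i : P.-integrable setT (EFin \o delta i).
Proof.
apply/integrableP; split; first exact/measurable_EFinP.
rewrite (@ge0_expectation_gaussian i (fun x => `|x%:E|%E)).
- by case/integrableP : (integrable_normal_id hnu).
- by apply: measurableT_comp => //; exact/measurable_EFinP.
- by move=> x; exact: abse_ge0.
Qed.

Lemma integral_noise i : (\int[P]_w (delta i w)%:E = 0)%E.
Proof.
rewrite -(normal_mean hnu).
have m1 : measurable_fun setT (EFin : measurableTypeR R -> \bar R).
  exact/measurable_EFinP.
have := integral_distribution (X := borel_noise i) m1 (integrable_noise i).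
by rewrite /comp => <-; apply: eq_measure_integral => A mA _; exact: borel_noise_law.
Qed.

Lemma integrable_noise_prod i j :
  P.-integrable setT (EFin \o (delta i \* delta j)).
Proof.
have isq k : P.-integrable setT (EFin \o (fun w => delta k w ^+ 2)).
  apply/integrableP; split.
    by apply/measurable_EFinP; exact: measurable_funX.
  under eq_integral do rewrite /= ger0_norm ?sqr_ge0 //.
  by apply: le_lt_trans (noise_second_moment_le k) _; rewrite ltry.
apply: le_integrable (integrableD measurableT (isq i) (isq j)) => //.
  by apply/measurable_EFinP; exact: measurable_funM.
move=> w _ /=; rewrite lee_fin [leRHS]ger0_norm ?addr_ge0 ?sqr_ge0 //.
rewrite normrM -(real_normK (num_real (delta i w))) -(real_normK (num_real (delta j w))).
move: (`|delta i w|) (`|delta j w|) (normr_ge0 (delta i w)) (normr_ge0 (delta j w)).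
by move=> a b a0 b0; have := sqr_ge0 (a - b); nra.
Qed.

Lemma integral_noise_prod i j : i != j ->
  (\int[P]_w (delta i w * delta j w)%:E = 0)%E.
Proof.
move=> ij; rewrite integral_independent_product ?integral_noise ?mule0 //;
  [|exact: integrable_noise|exact: integrable_noise|exact: integrable_noise_prod].
move=> A B mA mB; case: hdelta => _ indep.
(* Independence of the whole family, with trivial events away from i and j. *)
pose S k : set (measurableTypeR R) := if k == i then A else if k == j then B else setT.
have mS k : measurable (S k) by rewrite /S; case: ifP => // _; case: ifP.
have := indep S mS.
have -> : \bigcap_(k in [set: 'I_n]) delta k @^-1` S k =
    delta i @^-1` A `&` delta j @^-1` B.
  apply/seteqP; split=> w /=.
    move=> wS; split.
      by have := wS i I; rewrite /S eqxx.
    by have := wS j I; rewrite /S eq_sym (negbTE ij) eqxx.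
  move=> [wA wB] k _; rewrite /S /=.
  by case: eqP => [->|_] //; case: eqP => [->|].
rewrite (bigD1 i) //= (bigD1 j) 1?eq_sym //= big1 => [|k /andP[ki kj]].
  by rewrite mule1 /S eqxx eq_sym (negbTE ij) eqxx.
by rewrite /S (negbTE ki) (negbTE kj) preimage_setT probability_setT.
Qed.

(** After expanding the square, the terms off the diagonal vanish: the noises are
    uncorrelated. *)
Lemma noise_sum_second_moment_le (b : 'I_n -> R) :
  (\int[P]_w ((\sum_(i < n) b i * delta i w) ^+ 2)%:E
   <= (nu ^+ 2 * \sum_(i < n) b i ^+ 2)%:E)%E.
Proof.
have -> : (fun w => ((\sum_(i < n) b i * delta i w) ^+ 2)%:E) =
    (fun w => \sum_(p : 'I_n * 'I_n)
       (b p.1 * b p.2)%:E * (delta p.1 w * delta p.2 w)%:E)%E.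
  apply/funext => w; rewrite expr2 big_distrlr /= pair_big /= -sumEFin.
  by apply: eq_bigr => p _; rewrite -EFinM; congr EFin; ring.
have ip (p : 'I_n * 'I_n) := integrable_noise_prod p.1 p.2.
rewrite integral_sum //; last by move=> p; exact: (integrableZl measurableT _ (ip p)).
under eq_bigr => p _ do rewrite (integralZl measurableT (ip p)).
rewrite -(pair_bigA _ (fun i j =>
  (b i * b j)%:E * \int[P]_w (delta i w * delta j w)%:E)%E) /=.
rewrite mulr_sumr -sumEFin; apply: lee_sum => i _.
rewrite (bigD1 i) //= big1 ?adde0; last first.
  by move=> j ji; rewrite integral_noise_prod ?mule0 // eq_sym.
rewrite -expr2 [X in (_ <= X%:E)%E]mulrC [leRHS]EFinM.
apply: lee_wpmul2l; first by rewrite lee_fin sqr_ge0.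
exact: noise_second_moment_le.
Qed.

(** The pointwise bound [|W| <= (W^2 / sigma + sigma) / 2], with [sigma] slightly
    above the standard deviation so that it is positive even for [b = 0], gives
    the first moment from the second. *)
Lemma expectation_affine_noise_le (a : R) (b : 'I_n -> R) :
  ('E_P[(fun w => `|a + \sum_(i < n) b i * delta i w|)%R]
   <= (`|a| + nu * Num.sqrt (\sum_(i < n) b i ^+ 2))%:E)%E.
Proof.
have mW : measurable_fun setT (fun w => \sum_(i < n) b i * delta i w).
  by apply: measurable_sum => i; exact: measurable_funM.
set S := \sum_(i < n) b i ^+ 2.
have S0 : 0 <= S by apply: sumr_ge0 => i _; exact: sqr_ge0.
rewrite unlock; apply/lee_addgt0Pr => eps eps0.
pose sigma := nu * Num.sqrt S + eps.
have sigma0 : 0 < sigma by rewrite ltr_wpDl // mulr_ge0 ?sqrtr_ge0 // ltW.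
have mW2 : measurable_fun setT (fun w => ((\sum_(i < n) b i * delta i w) ^+ 2)%:E).
  by apply/measurable_EFinP; exact: measurable_funX.
apply: (@le_trans _ _ (\int[P]_w ((`|a| + sigma / 2)%:E +
    (2 * sigma)^-1%:E * ((\sum_(i < n) b i * delta i w) ^+ 2)%:E))%E).
  apply: ge0_le_integral => //.
  - apply/measurable_EFinP; apply: measurableT_comp => //.
    exact: measurable_funD.
  - by apply: emeasurable_funD => //; exact: measurable_funeM.
  move=> w _; rewrite -EFinM -EFinD lee_fin -addrA.
  apply: le_trans (ler_normD _ _) _; rewrite lerD2l.
  set W := \sum_(i < n) _.
  have -> : sigma / 2 + (2 * sigma)^-1 * W ^+ 2 = (sigma ^+ 2 + W ^+ 2) / (2 * sigma).
    by field; rewrite gt_eqF.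
  rewrite ler_pdivlMr ?mulr_gt0 // -[W ^+ 2](real_normK (num_real W)).
  by have := sqr_ge0 (`|W| - sigma); nra.
rewrite ge0_integralD //; last 3 first.
- by move=> w _; rewrite lee_fin addr_ge0 // divr_ge0 // ltW.
- by move=> w _; rewrite mule_ge0 // lee_fin ?sqr_ge0 // invr_ge0 mulr_ge0 // ltW.
- exact: measurable_funeM.
rewrite integral_cst //= probability_setT mule1 ge0_integralZl //; last 2 first.
- by move=> w _; rewrite lee_fin sqr_ge0.
- by rewrite lee_fin invr_ge0 mulr_ge0 // ltW.
have c0 : (0 <= (2 * sigma)^-1%:E :> \bar R)%E.
  by rewrite lee_fin invr_ge0 mulr_ge0 // ltW.
apply: le_trans (leeD (lexx _) (lee_wpmul2l c0 (noise_sum_second_moment_le b))) _.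
rewrite -EFinM -!EFinD lee_fin -!addrA lerD2l -/sigma -/S.
have Ssigma : nu ^+ 2 * S <= sigma ^+ 2.
  rewrite -{1}(sqr_sqrtr S0) -exprMn lerXn2r ?nnegrE ?mulr_ge0 ?sqrtr_ge0 ?ltW //.
  by rewrite /sigma ltrDl.
have -> : sigma / 2 + (2 * sigma)^-1 * (nu ^+ 2 * S) =
    (sigma ^+ 2 + nu ^+ 2 * S) / (2 * sigma).
  by field; rewrite gt_eqF.
by rewrite ler_pdivrMr ?mulr_gt0 //; nra.
Qed.

End gaussian_noise.

(** * Choice of the regularization parameter *)

Section tradeoff.
Context (R : realType).
Implicit Types (A K b l : R).

Let cube_root (x : R) : 0 < x ->
  [/\ 0 < x `^ 3^-1, (x `^ 3^-1) ^+ 3 = x & (x `^ 3^-1) ^+ 2 = x `^ (2 / 3)].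
Proof.
move=> x0; split; first exact: powR_gt0.
- by rewrite -powR_mulrn ?powR_ge0 // -powRrM mulVf // powRr1 // ltW.
- by rewrite -powR_mulrn ?powR_ge0 // -powRrM mulrC.
Qed.

(** In the variable [t = sqrt l] and with [K = A t0^3 / 2], which is the
    stationarity condition, the excess over the value at [t0] is a perfect square
    times a positive factor. *)
Lemma tradeoff_gap A t t0 : t != 0 -> t0 != 0 ->
  (A * t + A * t0 ^+ 3 / 2 / t ^+ 2) - (A * t0 + A * t0 ^+ 3 / 2 / t0 ^+ 2)
  = A * (2 * t + t0) / (2 * t ^+ 2) * (t - t0) ^+ 2.
Proof. by move=> tn0 t0n0; field; rewrite tn0 t0n0. Qed.

Lemma tradeoff_minimizer A K b : 0 < A -> 0 < K ->
  let B l := b + (A * l `^ 2^-1 + K / l) in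
  let l0 := (2 * K / A) `^ (2 / 3) in
  minimizer B l0 /\ forall l, minimizer B l -> l = l0.
Proof.
move=> A0 K0 B l0.
have x0 : 0 < 2 * K / A by rewrite divr_gt0 ?mulr_gt0.
have [t00 t03 t02] := cube_root x0; set t0 := _ `^ 3^-1 in t00 t03 t02.
have KE : K = A * t0 ^+ 3 / 2 by rewrite t03; field; rewrite gt_eqF.
have Bt t : 0 < t -> B (t ^+ 2) - B l0 =
    A * (2 * t + t0) / (2 * t ^+ 2) * (t - t0) ^+ 2.
  move=> tgt0; rewrite /B /l0 -t02 !powR12_sqrt ?sqr_ge0 // !sqrtr_sqr.
  rewrite !gtr0_norm // -tradeoff_gap ?gt_eqF // -KE.
  by rewrite opprD addrACA subrr add0r.
have coef_gt0 t : 0 < t -> 0 < A * (2 * t + t0) / (2 * t ^+ 2).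
  by move=> tgt0; rewrite divr_gt0 ?mulr_gt0 ?exprn_gt0 ?addr_gt0 ?mulr_gt0.
have sq l : 0 < l -> exists2 t, 0 < t & l = t ^+ 2.
  by move=> lgt0; exists (Num.sqrt l); rewrite ?sqrtr_gt0 // sqr_sqrtr // ltW.
have l00 : 0 < l0 by exact: powR_gt0.
split=> [|l [lgt0 lmin]].
  split=> // l /sq[t tgt0 ->]; rewrite -subr_ge0 Bt //.
  by rewrite mulr_ge0 ?sqr_ge0 // ltW // coef_gt0.
have [t tgt0 lt] := sq l lgt0.
have := lmin l0 l00; rewrite lt -subr_le0 Bt // pmulr_rle0 ?coef_gt0 //.
move=> tt0; have : (t - t0) ^+ 2 == 0 by rewrite eq_le tt0 sqr_ge0.
by rewrite sqrf_eq0 subr_eq0 => /eqP ->.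
Qed.

(** The factor between the minimizer and the rate does not depend on [n], [nu] or
    [h] because the coefficient of [1 / l] depends on them only through [rho], and
    [b] does not move the minimizer; so one constant serves as both the lower and
    the upper factor. *)
Lemma minimal_for_tradeoff (B : nat -> R -> R -> R -> R) (rate rho : nat -> R -> R)
    (b : nat -> R -> R -> R) A K : 0 < A -> 0 < K ->
  (forall n nu, (0 < n)%N -> 0 < nu -> 0 < rho n nu) ->
  (forall n nu, (0 < n)%N -> 0 < nu -> rate n nu = rho n nu `^ (2 / 3)) ->
  (forall n nu h l, (0 < n)%N -> 0 < nu -> 0 < l ->
    B n nu h l = b n nu h + (A * l `^ 2^-1 + K * rho n nu / l)) ->
  minimal_for B rate.
Proof.
move=> A0 K0 rho0 rateE BE.
exists ((2 * K / A) `^ (2 / 3)), ((2 * K / A) `^ (2 / 3)).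
have x0 : 0 < 2 * K / A by rewrite divr_gt0 ?mulr_gt0.
split; [exact: powR_gt0|exact: powR_gt0|move=> n nu h n0 nu0 _].
have r0 := rho0 n nu n0 nu0.
have [] := tradeoff_minimizer (b n nu h) A0 (mulr_gt0 K0 r0).
set F := fun l => _; set l0 := _ `^ _ => F0 Funiq.
have l0E : l0 = (2 * K / A) `^ (2 / 3) * rate n nu.
  rewrite rateE // -powRM ?(ltW x0) ?(ltW r0) // /l0.
  by congr (_ `^ _); ring.
have minE l : minimizer (B n nu h) l <-> minimizer F l.
  by split=> -[lgt0 lmin]; split=> // l' l'0; have := lmin l' l'0; rewrite !BE.
split; first by exists l0; apply/minE.
by move=> l /minE/Funiq ->; rewrite -l0E lexx.
Qed.

(** Here [rho = nu / sqrt n], and [rho ^ (2/3) = (nu^2 / n) ^ (1/3)]. *)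
Lemma minimal_for_error_bound (a1 Cf c E g : R) :
  0 < a1 -> 0 < Cf -> 0 < c -> 0 < E ->
  minimal_for (error_bound a1 Cf c E g) (fun m nu => (nu ^+ 2 / m%:R) `^ 3^-1).
Proof.
move=> a10 Cf0 c0 E0.
apply: (@minimal_for_tradeoff _ _ (fun n nu => nu / Num.sqrt n%:R)
  (fun _ _ h => a1 * Cf * h `^ g) (a1 * Cf) (a1 * c ^+ 2 * E)).
- by rewrite mulr_gt0.
- by rewrite !mulr_gt0 ?exprn_gt0.
- by move=> n nu n0 nu0; rewrite divr_gt0 // sqrtr_gt0 ltr0n.
- move=> n nu n0 nu0; have r0 : 0 < nu / Num.sqrt n%:R.
    by rewrite divr_gt0 // sqrtr_gt0 ltr0n.
  rewrite powRrM powR_mulrn ?(ltW r0) // expr_div_n sqr_sqrtr ?ler0n //.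
- move=> n nu h l n0 nu0 l0; rewrite /error_bound.
  have s0 : 0 < Num.sqrt n%:R :> R by rewrite sqrtr_gt0 ltr0n.
  by field; rewrite !gt_eqF.
Qed.

Lemma minimal_for_trace_error_bound (a1 Cf c E C2 g : R) :
  0 < a1 -> 0 < Cf -> 0 < c -> 0 < E -> 0 < C2 ->
  minimal_for (trace_error_bound a1 Cf c E C2 g)
    (fun m nu => (nu / m%:R) `^ (2 / 3)).
Proof.
move=> a10 Cf0 c0 E0 C20.
apply: (@minimal_for_tradeoff _ _ (fun n nu => nu / n%:R)
  (fun _ _ h => a1 * Cf * h `^ g) (a1 * Cf) (a1 * c * E * C2)) => //.
- by rewrite mulr_gt0.
- by rewrite !mulr_gt0.
- by move=> n nu n0 nu0; rewrite divr_gt0 // ltr0n.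
- move=> n nu h l n0 nu0 l0; rewrite /trace_error_bound.
  by field; rewrite gt_eqF // pnatr_eq0 -lt0n.
Qed.

End tradeoff.

(** * Bias, noise and the expected error *)

Section estimation_error.
Context (R : realType) (d : nat) (X : set 'rV[R]_d).
Context (H1 H2 : completeNormedModType R).
Context (ip1 : {dot H1 for idfun}) (hip1 : inner_product ip1).
Context (ip2 : {dot H2 for idfun}) (hip2 : inner_product ip2).
Context (ev : H2 -> 'rV[R]_d -> R) (A : {linear H1 -> H2}).
Context (J : set nat) (sigma : nat -> R) (u : nat -> H2) (v : nat -> H1).
Context (hsvd : singular_system ip1 ip2 A J sigma u v).
Context (phi : 'rV[R]_d -> H1).
Context (hAphi : forall w x, X x -> ev (A w) x = ip1 w (phi x)).
Context (c : R) (hc : forall x, X x -> `|phi x| <= c).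
Context (tau Ce : R).
Context (hCe : forall g, range A g ->
     sobolev X tau (ev g) /\
     sobolev_norm X tau (ev g) <= Ce * HK_norm ip1 ip2 A g).
Context (C h0 : R) (hC : 0 < C).
Context (designs : forall m, set ('I_m -> 'rV[R]_d)).
Context (hsampling : sampling_inequality X tau C h0 (@designs)).
Context (n : nat) (hn : (0 < n)%N) (x : 'I_n -> 'rV[R]_d).
Context (hx : forall i, X (x i)) (hdesign : @designs n x).
Context (hfill : fill_distance X x <= h0).
Context (s : R -> R -> R) (D E q : R) (Ca : R -> R).
Context (hs : regularization_family (sampling_opnorm ip1 phi x ^+ 2) s D E q Ca).
Context (lam : R) (hlam : 0 < lam).
Context (m : nat) (e : 'I_m -> H1) (t : 'I_m -> R).
Context (he : orthonormal_on ip1 setT e).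
Context (hT : forall w, sampling_normal_op ip1 phi x w
                        = \sum_(i < m) (t i * ip1 w (e i)) *: e i).
Local Notation fc := (spectral_fun ip1 e t).
Local Notation h := (fill_distance X x).
Let r l := 1 - l * s lam l.
Let I0 : 0 <= (0 : R) <= sampling_opnorm ip1 phi x ^+ 2.
Proof. by rewrite lexx sqr_ge0. Qed.
Let It i : 0 <= t i <= sampling_opnorm ip1 phi x ^+ 2.
Proof. exact: (sampling_eigenvalue hip1 hn i (fun j => hc (hx j)) he hT). Qed.

Lemma residual_norm_le f : `|fc r f| <= (D + 1) * `|f|.
Proof.
case: hs => hD _ _ _ _.
have D0 : 0 <= D := le_trans (normr_ge0 _) (hD lam 0 hlam I0).
have rD l : 0 <= l <= sampling_opnorm ip1 phi x ^+ 2 -> `|r l| <= D + 1.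
  move=> Il; rewrite addrC /r; apply: le_trans (ler_normB _ _) _.
  by rewrite normr1 lerD2l hD.
by apply: (norm_spectral_fun hip1 he) => [|i|]; [rewrite addr_ge0|exact: rD|exact: rD].
Qed.

(** With [z = r(T) f] the squared norm of the samples is
    [<T z, z> = <(r T r)(T) f, f>], and the qualification at exponent 1/2 bounds
    [r l * l * r l = (sqrt l * r l)^2]. *)
Lemma residual_sampling_le f :
  nnorm (sampling_op ip1 phi x (fc r f)) <= Ca 2^-1 * lam `^ 2^-1 * `|f|.
Proof.
case: hs => _ _ hq hCa hqual.
have q2 : 0 <= (2^-1 : R) <= q by rewrite invr_ge0 ler0n.
have M0 : 0 <= Ca 2^-1 * lam `^ 2^-1 by rewrite mulr_ge0 ?powR_ge0 ?ltW ?hCa.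
rewrite -(@ler_pXn2r _ 2) ?nnegrE ?nnorm_ge0 ?(mulr_ge0 M0) ?normr_ge0 //.
rewrite exprMn sqr_nnorm_sampling_op.
have -> w : sampling_normal_op ip1 phi x w = fc id w.
  by rewrite hT /spectral_fun scale0r addr0.
rewrite -spectral_fun_sym !(spectral_fun_comp he).
have M l : 0 <= l <= sampling_opnorm ip1 phi x ^+ 2 ->
    `|r l * l * r l| <= (Ca 2^-1 * lam `^ 2^-1) ^+ 2.
  move=> Il; have := hqual _ _ _ q2 hlam Il.
  have /andP[l0 _] := Il; rewrite powR12_sqrt // => le.
  have -> : r l * l * r l = (Num.sqrt l * r l) ^+ 2.
    by rewrite exprMn sqr_sqrtr //; ring.
  by rewrite normrX lerXn2r ?nnegrE.
by apply: (ip_spectral_fun_le hip1 he) => [|i|];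
  [rewrite sqr_ge0|exact: (M _ (It i))|exact: (M _ I0)].
Qed.

(** The embedding bounds the seminorm by [Ce] times the norm of [A (r(T) f)] in
    [R(A)].  Nothing forces [Ce] to be nonnegative; if it is negative, the
    embedding makes the norm of [g] vanish, so that [f = 0] and both sides are
    at most 0. *)
Lemma residual_seminorm_le f g : range A g -> f = moore_penrose ip1 ip2 A g ->
  sobolev_seminorm X tau (ev (A (fc r f))) <= Ce * (D + 1) * `|f|.
Proof.
move=> rg fg.
have [sz sHK] := hCe (imageT A (fc r f)).
apply: le_trans (sobolev_seminorm_le sz) _; apply: le_trans sHK _.
have HKf := HK_norm_le hip1 hip2 hsvd (fc r f).
have HK0 : 0 <= HK_norm ip1 ip2 A (A (fc r f)) by exact: sqrtr_ge0.
have Dr := residual_norm_le f.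
rewrite -mulrA; have [Ce0|Ce0] := leP 0 Ce.
  by rewrite ler_wpM2l // (le_trans HKf).
have [_ sg] := hCe rg.
have := le_trans (sqrtr_ge0 _) sg; rewrite (HK_normE hip1) -fg => f0.
have fz : `|f| = 0.
  by apply/eqP; rewrite eq_le normr_ge0 andbT -(ler_nM2l Ce0) mulr0.
by rewrite fz !mulr0; apply: mulr_le0_ge0 => //; exact: ltW.
Qed.

Lemma bias_le f g alpha psi : range A g -> f = moore_penrose ip1 ip2 A g ->
  in_A1 X phi alpha psi ->
  `|ip1 psi (fc r f)| <= l1_norm alpha *
    (C * Num.max (Ce * (D + 1)) (Ca 2^-1) * `|f|
     * (h `^ (tau - d%:R / 2) + lam `^ 2^-1)).
Proof.
move=> rg fg hpsi; apply: (ip_test_function_le hip1 hpsi) => y Xy.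
rewrite (ipC ip1) -hAphi //.
have [sz _] := hCe (imageT A (fc r f)).
apply: le_trans (sampling_inequality_pointwise hsampling hn hdesign hx hfill sz Xy) _.
rewrite -!mulrA ler_pM2l //.
have -> : \row_i ev (A (fc r f)) (x i) = sampling_op ip1 phi x (fc r f).
  by apply/rowP => i; rewrite !mxE hAphi.
set M := Num.max _ _; rewrite mulrA mulrDr; apply: lerD.
  rewrite mulrC ler_wpM2r ?powR_ge0 //.
  apply: le_trans (residual_seminorm_le rg fg) _.
  by rewrite ler_wpM2r // le_max lexx.
apply: le_trans (residual_sampling_le f) _.
by rewrite mulrAC ler_wpM2r ?powR_ge0 // ler_wpM2r // le_max lexx orbT.
Qed.


Context (dO : measure_display) (Omega : measurableType dO).
Context (P : probability Omega R) (nu : R) (hnu : 0 < nu).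
Context (delta : 'I_n -> {RV P >-> R}) (hdelta : iid_gaussian nu delta).
Context (S : H1 -> H1) (hS : S = fc (s lam)).

Let b psi i := n%:R^-1 * ip1 (S psi) (phi (x i)).

(** Since [S] is symmetric, it can be moved to the test function, where the data
    only meet [S psi] through its samples. *)
Lemma error_decomposition f psi w :
  ip1 psi (S (sampling_adj phi x (\row_i (ev (A f) (x i) + delta i w))) - f)
  = - ip1 psi (fc r f) + \sum_(i < n) b psi i * delta i w.
Proof.
rewrite ipBr {1}hS -spectral_fun_sym -hS ip_sampling_adj.
have -> : ip1 psi (fc r f) =
    ip1 psi f - n%:R^-1 * \sum_(i < n) ip1 f (phi (x i)) * ip1 (S psi) (phi (x i)).
  have TE : fc id f = sampling_normal_op ip1 phi x f.
    by rewrite hT /spectral_fun scale0r addr0.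
  rewrite spectral_fun_one_sub ipBr; congr (_ - _).
  have -> : fc (fun l => l * s lam l) f = S (fc id f).
    rewrite hS (spectral_fun_comp he); congr (spectral_fun _ _ _ _ _).
    by apply/funext => l; rewrite mulrC.
  rewrite {1}hS -spectral_fun_sym -hS TE ip_sampling_adj.
  by congr (_ * _); apply: eq_bigr => i _; rewrite mxE.
rewrite opprB addrAC; congr (_ - _).
rewrite !mulr_sumr -big_split; apply: eq_bigr => i _ /=.
by rewrite mxE hAphi // /b; ring.
Qed.

(** The standard deviation of the noise term is [nu / sqrt n] times the norm of
    the samples of [S psi], and [|S psi| <= E / lam * |psi|]. *)
Lemma noise_level_le kappa psi : 0 <= kappa ->
  (forall w, nnorm (sampling_op ip1 phi x w) <= kappa * `|w|) ->
  nu * Num.sqrt (\sum_(i < n) b psi i ^+ 2)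
  <= kappa * (nu / Num.sqrt n%:R) * (E / lam) * `|psi|.
Proof.
move=> k0 hk; case: hs => _ hE _ _ _.
have EI l : 0 <= l <= sampling_opnorm ip1 phi x ^+ 2 -> `|s lam l| <= E / lam.
  by move=> Il; rewrite ler_pdivlMr // mulrC -{1}(gtr0_norm hlam) -normrM hE.
have El0 : 0 <= E / lam := le_trans (normr_ge0 _) (EI 0 I0).
have Spsi : `|S psi| <= E / lam * `|psi|.
  by rewrite hS; apply: (norm_spectral_fun hip1 he) => [|i|] //; exact: EI.
have sn : 0 < Num.sqrt n%:R :> R by rewrite sqrtr_gt0 ltr0n.
have -> : Num.sqrt (\sum_(i < n) b psi i ^+ 2) =
    nnorm (sampling_op ip1 phi x (S psi)) / Num.sqrt n%:R.
  rewrite /nnorm -sqrtrV ?ler0n // -sqrtrM ?mulr_ge0 ?invr_ge0 ?ler0n //; last first.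
    by rewrite sumr_ge0 // => i _; exact: sqr_ge0.
  congr Num.sqrt; rewrite mulrAC -expr2 mulr_sumr.
  by apply: eq_bigr => i _; rewrite mxE exprMn.
rewrite mulrCA [leRHS](_ : _ = kappa * (E / lam * `|psi|) * (nu / Num.sqrt n%:R)).
  rewrite ler_wpM2r ?divr_ge0 ?(ltW hnu) ?(ltW sn) //.
  by apply: le_trans (hk _) _; rewrite ler_wpM2l.
by ring.
Qed.

Lemma expected_error_le kappa f g alpha psi : 0 <= kappa ->
  (forall w, nnorm (sampling_op ip1 phi x w) <= kappa * `|w|) ->
  range A g -> f = moore_penrose ip1 ip2 A g -> in_A1 X phi alpha psi ->
  ('E_P[(fun w =>
     `|ip1 psi (S (sampling_adj phi x (\row_i (ev g (x i) + delta i w))) - f)|)%R]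
   <= (l1_norm alpha *
       (C * Num.max (Ce * (D + 1)) (Ca 2^-1) * HK_norm ip1 ip2 A g
          * (h `^ (tau - d%:R / 2) + lam `^ 2^-1)
        + c * kappa * (nu / Num.sqrt n%:R) * (E / lam)))%:E)%E.
Proof.
move=> k0 hk rg fg hpsi.
have gE : g = A f by rewrite fg (A_moore_penrose hip1 hip2 hsvd rg).
rewrite [X in ('E_P[X] <= _)%E](_ : _ =
    fun w => `|- ip1 psi (fc r f) + \sum_(i < n) b psi i * delta i w|); last first.
  by apply/funext => w; rewrite {1}gE error_decomposition.
apply: le_trans (expectation_affine_noise_le hnu hdelta _ _) _.
rewrite lee_fin mulrDr normrN; apply: lerD.
  rewrite (HK_normE hip1) -fg; exact: bias_le rg fg hpsi.
apply: le_trans (noise_level_le _ k0 hk) _.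
have El0 : 0 <= E / lam.
  case: hs => _ hE _ _ _; rewrite divr_ge0 ?(ltW hlam) //.
  exact: le_trans (normr_ge0 _) (hE lam 0 hlam I0).
have nn0 : 0 <= nu / Num.sqrt n%:R by rewrite divr_ge0 ?sqrtr_ge0 // ltW.
rewrite [leRHS](_ : _ = kappa * (nu / Num.sqrt n%:R) * (E / lam) * (c * l1_norm alpha)).
  apply: ler_wpM2l; first exact: mulr_ge0 (mulr_ge0 k0 nn0) El0.
  exact: (norm_test_function_le hip1 hpsi hc).
by ring.
Qed.

End estimation_error.


Theorem proposition6
  (R : realType)
  (* the domain *)
  (d : nat) (hd : (0 < d)%N) (X : set 'rV[R]_d)
  (hXb : bounded_set X) (hXc : interior_cone_condition X)
  (* the Hilbert spaces *)
  (H1 H2 : completeNormedModType R)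
  (ip1 : {dot H1 for idfun}) (hip1 : inner_product ip1)
  (ip2 : {dot H2 for idfun}) (hip2 : inner_product ip2)
  (ev : H2 -> 'rV[R]_d -> R) (hev : function_space X ev)
  (* the operator, its singular system and the features phi_x *)
  (A : {linear H1 -> H2}) (hA : compact_operator A)
  (J : set nat) (sigma : nat -> R) (u : nat -> H2) (v : nat -> H1)
  (hsvd : singular_system ip1 ip2 A J sigma u v)
  (phi : 'rV[R]_d -> H1)
  (hphi : forall x, X x ->
     series (fun j => if j \in J then (sigma j * ev (u j) x) *: v j else 0)
       @ \oo --> phi x)
  (hAphi : forall w x, X x -> ev (A w) x = ip1 w (phi x))
  (c : R) (hc : forall x, X x -> `|phi x| <= c)
  (* the continuous embedding of H_K = R(A) into W_2^tau(X) *)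
  (tau : R) (htau : d%:R / 2 < tau) (Ce : R)
  (hCe : forall g, range A g ->
     sobolev X tau (ev g) /\
     sobolev_norm X tau (ev g) <= Ce * HK_norm ip1 ip2 A g)
  (* the constants of the sampling inequality *)
  (C h0 : R) (hC : 0 < C) (hh0 : 0 < h0)
  (designs : forall m, set ('I_m -> 'rV[R]_d))
  (hsampling : sampling_inequality X tau C h0 designs)
  (* the data *)
  (g : H2) (hg : range A g)
  (n : nat) (hn : (0 < n)%N) (x : 'I_n -> 'rV[R]_d)
  (hx : forall i, X (x i)) (hdesign : designs n x)
  (hfill : fill_distance X x <= h0)
  (dO : measure_display) (Omega : measurableType dO) (P : probability Omega R)
  (nu : R) (hnu : 0 < nu) (delta : 'I_n -> {RV P >-> R})
  (hdelta : iid_gaussian nu delta)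
  (* the regularization *)
  (s : R -> R -> R) (D E q : R) (Ca : R -> R)
  (hs : regularization_family (sampling_opnorm ip1 phi x ^+ 2) s D E q Ca)
  (lam : R) (hlam : 0 < lam)
  (S : H1 -> H1)
  (hS : spectral_calculus ip1 (s lam) (sampling_normal_op ip1 phi x) S)
  (* the test function *)
  (alpha : nat -> R) (psi : H1) (hpsi : in_A1 X phi alpha psi) :
  let f := moore_penrose ip1 ip2 A g in
  let y_delta om := \row_(i < n) (ev g (x i) + delta i om) in
  let f_hat om := S (sampling_adj phi x (y_delta om)) in
  let err om := `|ip1 psi (f_hat om - f)| in
  let h := fill_distance X x in
  let C' := C * Num.max (Ce * (D + 1)) (Ca 2^-1) in
  let Cf := C' * HK_norm ip1 ip2 A g in
  let nondegenerate :=
    [/\ 0 < l1_norm alpha, g != 0, 0 < c & 0 < E] in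
  [/\ ('E_P[err] <=
        (error_bound (l1_norm alpha) Cf c E (tau - d%:R / 2) n nu h lam)%:E)%E,
      nondegenerate ->
        minimal_for
          (error_bound (l1_norm alpha) Cf c E (tau - d%:R / 2))
          (fun m nu' => (nu' ^+ 2 / m%:R) `^ 3^-1) &
      forall A_star : H2 -> H1, is_adjoint ip1 ip2 A A_star ->
        trace_class ip1 (A_star \o A) ->
        (* C'' bounds the trace norm of A_n^* A_n, also in the sense that
           C''^2 bounds n times it, as the noise estimate needs *)
        forall C'' : R, 0 < C'' ->
          (trace_norm ip1 (sampling_normal_op ip1 phi x) <= C''%:E)%E ->
          (n%:R%:E * trace_norm ip1 (sampling_normal_op ip1 phi x) <= (C'' ^+ 2)%:E)%E ->
          ('E_P[err] <=
            (trace_error_bound (l1_norm alpha) Cf c E C''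
               (tau - d%:R / 2) n nu h lam)%:E)%E /\
          (nondegenerate ->
             minimal_for
               (trace_error_bound (l1_norm alpha) Cf c E C''
                  (tau - d%:R / 2))
               (fun m nu' => (nu' / m%:R) `^ (2 / 3)))].
Proof.
move=> f y_delta f_hat err h C' Cf nondeg.
have c0 : 0 <= c := le_trans (normr_ge0 _) (hc _ (hx (Ordinal hn))).
case: hS => m [e [t [he hT hSE]]].
have SE : S = spectral_fun ip1 e t (s lam) by apply/funext.
have bound kappa : 0 <= kappa ->
    (forall w, nnorm (sampling_op ip1 phi x w) <= kappa * `|w|) ->
    ('E_P[err] <= (l1_norm alpha * (Cf * (h `^ (tau - d%:R / 2) + lam `^ 2^-1)
        + c * kappa * (nu / Num.sqrt n%:R) * (E / lam)))%:E)%E.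
  move=> k0 hk.
  exact: (expected_error_le hip1 hip2 hsvd hAphi hc hCe hC hsampling hn hx
    hdesign hfill hs hlam he hT hnu hdelta SE k0 hk hg erefl hpsi).
have phic i : `|phi (x i)| <= c by exact: hc.
have Cf_gt0 : nondeg -> 0 < Cf.
  case=> _ g0 _ _; rewrite mulr_gt0 //.
    rewrite mulr_gt0 // lt_max; case: hs => _ _ q2 Ca0 _.
    by rewrite Ca0 ?orbT // invr_ge0 ler0n.
  rewrite (HK_normE hip1) normr_gt0; apply: contra_neq g0 => f0.
  by rewrite -(A_moore_penrose hip1 hip2 hsvd hg) f0 linear0.
split.
- rewrite /error_bound expr2; apply: bound c0 _ => w.
  exact: nnorm_sampling_op_le.
- move=> nd; case: (nd) => a0 _ c1 E0.
  by apply: minimal_for_error_bound => //; exact: Cf_gt0.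
move=> A_star _ _ C'' C''0 _ htr; split; last first.
  move=> nd; case: (nd) => a0 _ c1 E0.
  by apply: minimal_for_trace_error_bound => //; exact: Cf_gt0.
have sn : 0 < Num.sqrt n%:R :> R by rewrite sqrtr_gt0 ltr0n.
have k0 : 0 <= C'' / Num.sqrt n%:R by rewrite divr_ge0 // ltW.
have := bound _ k0 (fun w => nnorm_sampling_trace hip1 hn w (ltW C''0) htr).
rewrite /trace_error_bound; set X1 := (X in (_ <= X%:E)%E).
set X2 := (X in _ -> (_ <= X%:E)%E).
suff -> : X1 = X2 by [].
rewrite /X1 /X2; congr (_ * (_ + _)).
rewrite -[in RHS](sqr_sqrtr (ler0n R n)).
by field; rewrite !gt_eqF.
Qed.
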